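(* For every positive constant $b$ there exists a constant $c_b$, depending only on $b$, such that the following holds. Let $\Gamma$ be a finite collection of curves in $\mathbb{R}^3$, such that each $\gamma\in\Gamma$ is parametrised by $t\mapsto (p_1^{\gamma}(t),p_2^{\gamma}(t),p_3^{\gamma}(t))$ for $t\in\mathbb{R}$, where $p_i^{\gamma}\in\mathbb{R}[t]$, $i=1,2,3$, are polynomials, not simultaneously constant, of degrees at most $b$. Let $J$ be the set of joints formed by $\Gamma$. Then $$\sum_{x\in J} N(x)^{1/2}\leq c_b\cdot |\Gamma|^{3/2}.$$
   Context: Let $\mathcal{F}$ be the family of all non-empty sets $\gamma\subseteq\mathbb{R}^3$ such that for every $x\in\gamma$ a basic neighbourhood of $x$ in $\gamma$ is either $\{x\}$ or a finite union of parametrised curves, each homeomorphic to a semi-open line segment with one endpoint the point $x$. If there is a parametrisation $f:[0,1)\to\mathbb{R}^3$ of one of these curves with $f(0)=x$ and $f'(0)\neq 0$, then the line through $x$ with direction $f'(0)$ is said to be tangent to $\gamma$ at $x$. Curves in $\mathbb{R}^3$ parametrised by real polynomials (i.e. images of such parametrisations) belong to $\mathcal{F}$. For $\Gamma\subset\mathcal{F}$, $T_x^{\Gamma}$ denotes the set of directions of all tangent lines at $x$ to the sets of $\Gamma$ passing through $x$ (it may be empty, and a single set may have several tangent lines at $x$). A point $x\in\mathbb{R}^3$ is a joint for (formed by) a collection $\Gamma\subset\mathcal{F}$ if $x$ belongs to at least one of the sets in $\Gamma$ and there exist at least three vectors in $T_x^{\Gamma}$ spanning $\mathbb{R}^3$.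 The multiplicity $N(x)$ of the joint $x$ is the number of triples of lines in $\mathbb{R}^3$ passing through $x$ whose directions are linearly independent vectors in $T_x^{\Gamma}$. *)

(* Defs.v *)
(* MathComp / MathComp-Analysis, over an arbitrary R : realType. *)
From HB Require Import structures.
From mathcomp Require Export all_boot all_order all_algebra.
From mathcomp Require Export finmap.
From mathcomp Require Export all_classical all_reals all_analysis.
Export Order.TTheory GRing.Theory Num.Theory.
Export numFieldNormedType.Exports.

Set Implicit Arguments.
Unset Strict Implicit.
Unset Printing Implicit Defensive.

Local Open Scope classical_set_scope.
Local Open Scope ring_scope.

Section Joints.
Variable R : realType.
Local Notation space := 'rV[R]_3.
Implicit Types (x v : space) (gamma C l : set space) (Gamma : set (set space)).

Definition line x v : set space := [set x + t *: v | t in [set: R]].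

(* f restricted to [0, 1) is a homeomorphism onto C (with inverse g) sending the
   endpoint 0 to x; the values of f outside [0, 1) are irrelevant. *)
Definition arc_param x C (f : R -> space) : Prop :=
  [/\ f 0 = x,
      [set f t | t in `[0, 1[] = C,
      {within `[0, 1[, continuous f} &
      exists2 g : space -> R, {within C, continuous g} &
        forall t : R, t \in `[0, 1[ -> g (f t) = t].

(* Some (relatively open) neighbourhood of x in gamma is the union of the
   finitely many members of Cs, each a half-open arc issuing from x. *)
Definition local_arcs gamma x (Cs : set (set space)) : Prop :=
  [/\ finite_set Cs,
      forall C, Cs C -> exists f, arc_param x C f &
      exists2 U : set space, open_nbhs x U &
        gamma `&` U = \bigcup_(C in Cs) C].

(* The derivative at 0 is one-sided, f being defined on [0, 1) only. *)
Definition tangent_line gamma x l : Prop :=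
  exists (Cs : set (set space)) C (f : R -> space) (d : space),
    [/\ local_arcs gamma x Cs, Cs C, arc_param x C f,
        t^-1 *: (f t - f 0) @[t --> 0^'+] --> d &
        d != 0 /\ l = line x d].

(* All nonzero direction vectors of the tangent lines, so this set is closed
   under multiplication by nonzero scalars. *)
Definition tangent_dirs Gamma x : set space :=
  [set v | v != 0 /\
    exists gamma, [/\ Gamma gamma, gamma x & tangent_line gamma x (line x v)]].

(* Three vectors are encoded as the rows of a 3 x 3 matrix. *)
Definition joint Gamma x : Prop :=
  (exists2 gamma, Gamma gamma & gamma x) /\
  exists V : 'M[R]_3, (forall i, tangent_dirs Gamma x (row i V)) /\ row_full V.

Definition joints Gamma : set space := [set x | joint Gamma x].

(* A triple of lines is an unordered one, i.e. a set of three lines (they are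
   pairwise distinct because their directions are linearly independent). *)
Definition joint_triples Gamma x : set (set (set space)) :=
  [set S | exists V : 'M[R]_3,
    [/\ forall i, tangent_dirs Gamma x (row i V), row_free V &
        S = [set line x (row i V) | i in [set: 'I_3]]]].

(* Cardinality, with value +oo on infinite sets. *)
Definition multiplicity Gamma x : \bar R := counting (joint_triples Gamma x).

(* Since (size q).-1 is the degree of q (0 for q = 0), the first condition says
   that the coordinates are not all constant. *)
Definition poly_curve (b : R) gamma : Prop :=
  exists p : 'I_3 -> {poly R},
    [/\ exists i, (1 < size (p i))%N,
        forall i, (size (p i)).-1%:R <= b &
        gamma = range (fun t : R => \row_i (p i).[t])].

End Joints.

(* Main.v *)
(* Handicap method (Zhang; Yu and Zhao).  Fix finitely many points, and process
   the conditions "the degree r part of the Taylor expansion at x vanishes", for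
   all points x and all r, on the n^3-dimensional space of
   polynomials of degree < n in each variable; the condition (x, r) comes at
   time r + b x, where the delay b x is an integer.  Let W x be the total drop in
   dimension caused by the conditions at x, so that the sum of the W x is n^3.
   Delaying x by one unit less changes W x by O(n^2) at most, so for n large the
   delays can be adjusted to give W x at least a prescribed w x, as soon as the
   sum of the w x is at most n^3 / 2.

   For a curve g through x let S g x be the number of r for which some polynomial
   surviving until (x, r) has a degree r part not vanishing in a tangent
   direction of g at x.  Pulling back to the parameter line, S g x summed over x
   is at most dim {polynomials of degree <= 3 B n} = O(n), B bounding the degrees
   of the curves.  As the order of the conditions is compatible with
   differentiation, W x <= S g1 x * S g2 x * S g3 x whenever g1, g2, g3 have
   independent tangents at x.  With N x such triples, N x * W x is therefore at
   most a constant times the cube of the sum over g of S g x, and taking w x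
   proportional to (N x)^(1/2) and summing cube roots over x gives the theorem. *)

From HB Require Import structures.
Require Import Defs.
From mathcomp Require Import zify ring lra.
From mathcomp Require Import -(notations) mpoly.

Set Implicit Arguments.
Unset Strict Implicit.
Unset Printing Implicit Defensive.

Local Open Scope ring_scope.

(** * Linear algebra and handicaps *)

Lemma dimv_diff (K : fieldType) (V : vectType K) (A C : {vspace V}) :
  \dim (A :\: C) = (\dim A - \dim (A :&: C))%N.
Proof. by rewrite -(dimv_cap_compl A C) addKn. Qed.

(** On a complement of [A :&: C] in [A], [phi] is injective and its image meets [D] only in 0, so
    this image fits beside [B :&: D] inside [B]. *)
Lemma dimv_diff_le_img (K : fieldType) (V V' : vectType K)
    (phi : 'Hom(V, V')) (A C : {vspace V}) (B D : {vspace V'}) :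
  (forall u, u \in A -> phi u \in B) ->
  (forall u, u \in A -> phi u \in D -> u \in C) ->
  (\dim (A :\: C) <= \dim (B :\: D))%N.
Proof.
move=> AB DC; pose A' := (A :\: C)%VS.
have A'A u : u \in A' -> u \in A by apply/subvP/diffvSl.
have A'0 u : u \in A' -> phi u \in D -> u = 0.
  move=> uA' uD; apply/eqP; rewrite -memv0 -(capv_diff A C) memv_cap uA'.
  exact: DC (A'A _ uA') uD.
have kerA' : (A' :&: lker phi = 0)%VS.
  apply/eqP; rewrite -subv0; apply/subvP=> u; rewrite memv_cap memv_ker memv0.
  by case/andP=> uA' /eqP uK; rewrite (A'0 u) // uK mem0v.
have capD : (phi @: A' :&: (B :&: D) = 0)%VS.
  apply/eqP; rewrite -subv0; apply/subvP=> _ /memv_capP[/memv_imgP[u uA' ->]].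
  by rewrite memv_cap => /andP[_ uD]; rewrite (A'0 u) // linear0 mem0v.
rewrite (dimv_diff B D) -(limg_dim_eq kerA').
have leB : (phi @: A' + (B :&: D) <= B)%VS.
  rewrite subv_add capvSl andbT.
  by apply/subvP=> _ /memv_imgP[u /A'A uA ->]; apply: AB.
have := dimvS leB.
have := dimv_sum_cap (phi @: A') (B :&: D)%VS.
by rewrite capD dimv0 addn0 => ->; lia.
Qed.

Lemma dimv_diff_le_card (K : fieldType) (V : vectType K) (I : finType)
    (P : {set I}) (f : I -> 'Hom(V, K^o)) (A C : {vspace V}) :
  (forall u, u \in A -> (forall i, i \in P -> f i u = 0) -> u \in C) ->
  (\dim (A :\: C) <= #|P|)%N.
Proof.
move=> AC; pose g u := \row_(j < #|P|) (f (enum_val j) u : K).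
have gP a u v : g (a *: u + v) = a *: g u + g v.
  by apply/rowP=> j; rewrite !mxE linearP.
pose gL := GRing.isLinear.Build K V 'rV[K]_#|P| _ g gP.
pose g' : {linear V -> 'rV[K]_#|P|} := HB.pack g gL.
have := @dimv_diff_le_img _ _ _ (linfun g') A C fullv 0%VS.
rewrite (dimv_diff fullv) capv0 dimv0 subn0 dimvf /dim /= mul1n; apply.
  by move=> *; apply: memvf.
move=> u uA; rewrite memv0. rewrite (lfunE g') => /eqP gu; apply: AC => // i iP.
by move/rowP: gu => /(_ (enum_rank_in iP i)); rewrite !mxE enum_rankK_in.
Qed.

Lemma sum_decrements (d : nat -> nat) m a :
  (forall t t', (t <= t')%N -> (d t' <= d t)%N) ->
  (\sum_(i < m) (d (a + i) - d (a + i).+1) = d a - d (a + m))%N.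
Proof.
move=> dle; elim: m => [|m IH]; first by rewrite big_ord0 addn0 subnn.
rewrite big_ord_recr /= IH addnS.
have := dle a (a + m)%N; have := dle (a + m)%N (a + m).+1; lia.
Qed.

(** The times [s * k + x] run once through all numbers below [T * k], so the sum telescopes. *)
Lemma sum_decrements_mod (d : nat -> nat) k T :
  (forall t t', (t <= t')%N -> (d t' <= d t)%N) ->
  (\sum_(x < k) \sum_(s < T) (d (s * k + x) - d (s * k + x).+1) =
   d 0 - d (T * k))%N.
Proof.
move=> dle; rewrite exchange_big /=.
under eq_bigr => s _ do rewrite (sum_decrements k (s * k) dle) -mulSnr.
have /= := @sum_decrements (fun s => d (s * k)%N) T 0 _.
under eq_bigr => s _ do rewrite add0n.
rewrite add0n mul0n => -> // s s' ss'.
by rewrite dle // leq_mul2r ss' orbT.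
Qed.

(** * Handicaps for decreasing families of subspaces *)

Section Handicap.
Variables (K : fieldType) (E : vectType K) (k : nat).
Variable O : 'I_k -> nat -> {vspace E}.
Implicit Types (A : {vspace E}) (b : 'I_k -> nat) (x y : 'I_k).

(* [O x r] stands for the polynomials vanishing to order [r] at the point [x].
   Time [t = s * k + x] imposes the condition of order [s - b x] at [x], provided
   [b x <= s]; [nconds b t y] conditions have been imposed at [y] before [t]. *)
Definition nconds b t y := ((t + (k.-1 - y)) %/ k - b y)%N.
Definition admissible b t := (\bigcap_y O y (nconds b t y))%VS.
Definition weight A b T x :=
  (\sum_(s < T) (\dim (A :&: admissible b (s * k + x)) -
                 \dim (A :&: admissible b (s * k + x).+1)))%N.

Lemma nconds_lt b s x y : (x < y)%N -> nconds b (s * k + x) y = (s - b y)%N.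
Proof.
move=> xy; have yk := ltn_ord y; rewrite /nconds -addnA divnMDl; last by lia.
by rewrite [((x + _) %/ k)%N]divn_small ?addn0 //; lia.
Qed.

Lemma nconds_ge b s x y : (y < x)%N -> nconds b (s * k + x) y = (s.+1 - b y)%N.
Proof.
move=> xy; have yk := ltn_ord x; rewrite /nconds -addnA divnMDl; last by lia.
suff -> : ((x + (k.-1 - y)) %/ k = 1)%N by rewrite addn1.
have -> : (x + (k.-1 - y) = 1 * k + (x - y.+1))%N by lia.
by rewrite divnMDl ?divn_small //; lia.
Qed.

Lemma nconds_eq b s x : nconds b (s * k + x) x = (s - b x)%N.
Proof.
have xk := ltn_ord x; rewrite /nconds -addnA divnMDl; last by lia.
by rewrite [((x + _) %/ k)%N]divn_small ?addn0 //; lia.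
Qed.

Lemma nconds_step b s x y :
  nconds b (s * k + x).+1 y =
  if y == x then (s.+1 - b y)%N else nconds b (s * k + x) y.
Proof.
have [yk xk] := (ltn_ord y, ltn_ord x).
rewrite {1}/nconds -addnS -addnA divnMDl; last by lia.
case: ifP => [/eqP->|/eqP/eqP].
  have -> : (x.+1 + (k.-1 - x) = 1 * k + 0)%N by lia.
  by rewrite divnMDl ?div0n; lia.
rewrite -val_eqE /= neq_ltn => /orP[yx|xy].
  rewrite nconds_ge //.
  suff -> : ((x.+1 + (k.-1 - y)) %/ k = 1)%N by rewrite addn1.
  have -> : (x.+1 + (k.-1 - y) = 1 * k + (x - y))%N by lia.
  by rewrite divnMDl ?divn_small //; lia.
rewrite nconds_lt //.
by rewrite [((x.+1 + _) %/ k)%N]divn_small ?addn0 //; lia.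
Qed.

Lemma nconds_leq b t t' y : (t <= t')%N -> (nconds b t y <= nconds b t' y)%N.
Proof. by move=> tt'; rewrite leq_sub2r // leq_div2r // leq_add2r. Qed.

Lemma nconds_mul b s y : nconds b (s * k) y = (s - b y)%N.
Proof.
have yk := ltn_ord y; rewrite /nconds divnMDl; last by lia.
by rewrite divn_small ?addn0 //; lia.
Qed.

Lemma nconds_addk b t y : nconds b (t + k) y = (((t + (k.-1 - y)) %/ k).+1 - b y)%N.
Proof.
have yk := ltn_ord y.
by rewrite /nconds addnAC divnDr ?dvdnn // divnn (leq_ltn_trans _ yk) // addn1.
Qed.

Hypothesis O0 : forall x, O x 0 = fullv.
Hypothesis OS : forall x r, (O x r.+1 <= O x r)%VS.
Variable N : nat.
Hypothesis ON : forall x, O x N = 0%VS.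

Lemma vanishing_leq x r r' : (r <= r')%N -> (O x r' <= O x r)%VS.
Proof.
move=> /subnKC <-; elim: (r' - r)%N => [|d IH]; first by rewrite addn0.
by rewrite addnS; apply: subv_trans IH.
Qed.

Lemma admissibleP b t u :
  reflect (forall y, u \in O y (nconds b t y)) (u \in admissible b t).
Proof.
apply: (iffP idP) => [uU y|uO].
  by move: uU; rewrite memvE => /subv_bigcapP /(_ y isT); rewrite -memvE.
by rewrite memvE; apply/subv_bigcapP=> y _; rewrite -memvE.
Qed.

Lemma admissible_step b s x :
  admissible b (s * k + x).+1 =
  (admissible b (s * k + x) :&: O x (s.+1 - b x)%N)%VS.
Proof.
apply/vspaceP=> u; rewrite memv_cap; apply/admissibleP/andP.
  move=> uO; split; last by move: (uO x); rewrite nconds_step eqxx.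
  apply/admissibleP=> y; apply: subvP (uO y).
  exact/vanishing_leq/nconds_leq.
move=> [/admissibleP uO ux] y; rewrite nconds_step; case: eqP => [->|_] //.
Qed.

Lemma admissible_leq b t t' : (t <= t')%N -> (admissible b t' <= admissible b t)%VS.
Proof.
move=> tt'; apply/subvP=> u /admissibleP uO; apply/admissibleP=> y.
by apply: subvP (uO y); exact/vanishing_leq/nconds_leq.
Qed.

Lemma admissible0 b t x : ((N + b x) * k <= t)%N -> admissible b t = 0%VS.
Proof.
move=> tN; apply/eqP; rewrite -subv0 -(ON x); apply/subvP=> u /admissibleP /(_ x).
apply/subvP/vanishing_leq; rewrite -(addnK (b x) N) -nconds_mul.
exact: nconds_leq.
Qed.

Lemma admissible_start b : admissible b 0 = fullv.
Proof.
apply/vspaceP=> u; rewrite memvf; apply/admissibleP=> y.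
by rewrite -(mul0n k) nconds_mul O0 memvf.
Qed.

Lemma weightE A b T x :
  weight A b T x = (\sum_(s < T)
    \dim ((A :&: admissible b (s * k + x)) :\: O x (s.+1 - b x)%N))%N.
Proof.
by apply: eq_bigr => s _; rewrite admissible_step capvA -dimv_diff.
Qed.

(** The dimensions telescope from [\dim A] to 0, since the conditions up to order [N] at the single
    point [x] leave only 0. *)
Lemma sum_weight A b T x : ((N + b x) <= T)%N ->
  (\sum_y weight A b T y = \dim A)%N.
Proof.
move=> NT; pose d t := \dim (A :&: admissible b t).
have dle t t' : (t <= t')%N -> (d t' <= d t)%N.
  by move=> tt'; apply/dimvS/capvS => //; apply: admissible_leq.
rewrite [LHS](sum_decrements_mod k T dle) /d admissible_start capvf.
by rewrite (@admissible0 b _ x) ?capv0 ?dimv0 ?subn0 // leq_mul2r NT orbT.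
Qed.

Lemma weight_mono A A' b T x : (A <= A')%VS -> (weight A b T x <= weight A' b T x)%N.
Proof.
move=> /subvP AA'; rewrite !weightE; apply: leq_sum => s _.
apply: (@dimv_diff_le_img _ _ _ \1%VF) => u; last by rewrite id_lfunE.
by rewrite id_lfunE !memv_cap => /andP[/AA' -> ->].
Qed.

Definition lower_delay b x : 'I_k -> nat := fun y => if y == x then (b y).-1 else b y.

Lemma lower_delay_leq b x y : (lower_delay b x y <= b y)%N.
Proof. by rewrite /lower_delay; case: eqP => // _; rewrite leq_pred. Qed.

Lemma weight_lower_neq A b T x y : y != x ->
  (weight A (lower_delay b x) T y <= weight A b T y)%N.
Proof.
move=> yx; rewrite !weightE; apply: leq_sum => s _.
apply: (@dimv_diff_le_img _ _ _ \1%VF) => u; rewrite id_lfunE; last first.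
  by rewrite /lower_delay (negPf yx).
rewrite !memv_cap => /andP[-> /admissibleP uO]; apply/admissibleP=> z.
by apply: subvP (uO z); apply/vanishing_leq/leq_sub2l/lower_delay_leq.
Qed.

Section Lipschitz.
(** [E0] will consist of polynomials of degree so small that their multiples by the auxiliary
    polynomials stay in [E]. *)
Variables (E0 : {vspace E}) (phi : 'I_k -> 'End(E)).
Hypothesis phi_pres : forall x u r, u \in E0 -> u \in O x r -> phi x u \in O x r.
Hypothesis phi_incr : forall x y u r, y != x -> u \in E0 -> u \in O y r ->
  phi x u \in O y r.+1.
Hypothesis phi_refl : forall x u r, u \in E0 -> phi x u \in O x r -> u \in O x r.

(* Here [phi x] is multiplication by a polynomial vanishing at all points but [x]:
   it makes up for the order gained at the other points when [x] is advanced. *)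
Lemma weight_lower_sub b T x : (0 < b x)%N -> (N + b x <= T)%N ->
  (weight E0 (lower_delay b x) T x <= weight fullv b T x)%N.
Proof.
move=> bx NT.
(* The extra round contributes 0; it allows round [s] for the lowered delay to be compared with
   round [s.+1] for the old one. *)
have -> : weight fullv b T x = weight fullv b T.+1 x.
  rewrite {2}/weight big_ord_recr /= (@admissible0 b _ x) ?capv0 ?dimv0 ?addn0 //.
  by rewrite (leq_trans _ (leq_addr _ _)) // leq_mul2r NT orbT.
rewrite [leqRHS]weightE big_ord_recl weightE.
apply: leq_trans (leq_addl _ _); apply: leq_sum => s _.
apply: (@dimv_diff_le_img _ _ _ (phi x)) => u; rewrite !memv_cap.
  case/andP=> u0 /admissibleP uO; rewrite memvf /=; apply/admissibleP=> y.
  have tE : (bump 0 s * k + x = s * k + x + k)%N by rewrite /bump /= mulSn; lia.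
  have [->|yx] := eqVneq y x.
    apply: phi_pres => //; apply: subvP (uO x); apply: vanishing_leq.
    by rewrite !nconds_eq /lower_delay eqxx /= /bump leq0n; lia.
  have := phi_incr yx u0 (uO y); apply/subvP/vanishing_leq.
  by rewrite tE nconds_addk /nconds /lower_delay (negPf yx); lia.
case/andP=> u0 _ /(phi_refl u0); apply/subvP/vanishing_leq.
by rewrite /lower_delay eqxx /= /bump leq0n; lia.
Qed.

(** The weights sum to [\dim E0] inside [E0] and to [\dim {:E}] in the whole space, and none
    decreases in passing to the latter; so the weight at [x] grows by at most the codimension of
    [E0]. *)
Lemma weight_lower_eq b T x : (0 < b x)%N -> (N + b x <= T)%N ->
  (weight fullv (lower_delay b x) T x <=
   weight fullv b T x + (\dim {:E} - \dim E0))%N.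
Proof.
move=> bx NT; apply: leq_trans (leq_add (weight_lower_sub bx NT) (leqnn _)).
have NT' : (N + lower_delay b x x <= T)%N.
  by apply: leq_trans NT; rewrite leq_add2l lower_delay_leq.
have := sum_weight fullv NT'; have := sum_weight E0 NT'.
rewrite (bigD1 x) //= => <-; rewrite (bigD1 x) //= => <-.
have := weight_mono (lower_delay b x) T x (subvf E0).
have : (\sum_(i | i != x) weight E0 (lower_delay b x) T i <=
        \sum_(i | i != x) weight fullv (lower_delay b x) T i)%N.
  by apply: leq_sum => i _; apply/weight_mono/subvf.
suff aux m m' c c' : (c' <= c -> m' <= m -> m <= m' + (m + c - (m' + c')))%N.
  by move=> ? ?; apply: aux.
lia.
Qed.

(* If no delay lies in ]g, g + N], the points of delay at most g exhaust all the
   polynomials before the first condition is imposed at any other point. *)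
Lemma weight_gap b T g x y : (b x <= g)%N -> (g + N < b y)%N ->
  weight fullv b T y = 0%N.
Proof.
move=> bx byy; rewrite weightE big1 // => s _; rewrite dimv_diff.
have [sg|gs] := ltnP s (g + N)%N.
  have -> : (s.+1 - b y = 0)%N by lia.
  by rewrite O0 capvf subnn.
rewrite (@admissible0 b _ x) ?capv0 ?dimv0 ?cap0v ?dimv0 //.
by rewrite (leq_trans _ (leq_addr _ _)) // leq_mul2r; apply/orP; right; lia.
Qed.

Variables (F : realDomainType) (w : 'I_k -> F).
Hypothesis w0 : forall x, 0 <= w x.
Hypothesis w_small :
  \sum_x (w x + (\dim {:E} - \dim E0)%:R) < (\dim {:E})%:R.

(* Start from large equal delays and advance points of too small weight; an
   advanced point never gets weight more than [w x] plus the Lipschitz constant,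
   so a gap between the delays (see [weight_gap]), hence a zero delay, would
   contradict [sum_weight]. *)
Lemma handicaps_exist :
  exists b T, forall x, w x <= (weight fullv b T x)%:R.
Proof.
pose eps := (\dim {:E} - \dim E0)%N.
(* As [b0] exceeds [k * N], a point of delay at most [j * N] with [j <= k] has been advanced and
   obeys the bound in [good]. *)
pose b0 := (k * N).+1; pose T := (N + b0)%N.
pose good b := (forall x, b x <= b0)%N /\
  forall x, (b x < b0)%N -> (weight fullv b T x)%:R <= w x + eps%:R.
have good_pos b : good b -> forall x, (0 < b x)%N.
  move=> [bb0 gb] x; rewrite lt0n; apply/eqP=> bx0.
  (* Starting from a zero delay, each further interval of length [N] must contain a new delay, which
     would require more than [k] points. *)
  have step j : (j <= k)%N -> (j < #|[set y | b y <= j * N]|)%N.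
    elim: j => [_|j IH jk].
      by rewrite card_gt0; apply/set0Pn; exists x; rewrite inE bx0.
    apply: leq_ltn_trans (IH (ltnW jk)) _; apply: proper_card.
    apply/properP; split.
      by apply/fintype.subsetP=> y; rewrite !inE mulSn; lia.
    apply/exists_inP; apply: contraT => /exists_inPn gap.
    have gap' y : (j * N < b y)%N -> (j * N + N < b y)%N.
      move=> jy; rewrite ltnNge; apply/negP=> yj; have := gap y.
      by rewrite !inE mulSn addnC yj => /(_ isT); rewrite -ltnNge jy.
    have bT : (N + b x <= T)%N by rewrite leq_add2l.
    have := w_small; rewrite ltNge => /negP[].
    rewrite -{1}(sum_weight fullv bT) natr_sum.
    apply: ler_sum => y _; have [yj|/gap' yj] := leqP (b y) (j * N).
      apply: gb; rewrite ltnS (leq_trans yj) // leq_mul2r.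
      by rewrite (ltnW jk) orbT.
    by rewrite (@weight_gap b T (j * N) x y) ?bx0 ?addr_ge0 // ltW.
  have := step k (leqnn k); rewrite ltnNge => /negP[].
  by apply: leq_trans (max_card _) _; rewrite card_ord.
(* Induction on the sum of the delays. *)
suff main m b : (\sum_(x < k) b x <= m)%N -> good b ->
    exists b T, forall x, w x <= (weight fullv b T x)%:R.
  by apply: (main _ (fun=> b0) (leqnn _)); split=> // x; rewrite ltnn.
elim: m b => [|m IH] b.
  rewrite leqn0 sum_nat_eq0 => /forallP b00 gb; exists b, T => x.
  by have := b00 x; rewrite eqn0Ngt (good_pos b gb).
move=> bm gb; have [/forallP bw|] := boolP [forall x, w x <= (weight fullv b T x)%:R].
  by exists b, T.
rewrite negb_forall => /existsP[x]; rewrite -ltNge => wx.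
have bx := good_pos b gb x; have [bb0 gb'] := gb.
apply: (IH (lower_delay b x)).
  rewrite -ltnS; apply: leq_trans bm; rewrite (bigD1 x) //= [leqRHS](bigD1 x) //=.
  rewrite -addSn leq_add //; first by rewrite /lower_delay eqxx prednK.
  by apply: leq_sum => y _; apply: lower_delay_leq.
split=> y; first exact: leq_trans (lower_delay_leq _ _ _) (bb0 y).
have [->|yx] := eqVneq y x.
  move=> _; apply: le_trans (_ : (weight fullv b T x + eps)%:R <= _).
    by rewrite ler_nat weight_lower_eq // leq_add2l.
  by rewrite natrD lerD2r ltW.
rewrite /lower_delay (negPf yx) => /gb'; apply: le_trans.
by rewrite ler_nat weight_lower_neq.
Qed.
End Lipschitz.
End Handicap.

(** * Polynomials in three variables *)

Lemma deriv_XsubC_exp (K : comNzRingType) (t : K) j :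
  (('X - t%:P) ^+ j)^`() = ('X - t%:P) ^+ j.-1 *+ j.
Proof. by rewrite deriv_exp derivXsubC mul1r. Qed.

(** In characteristic 0, a zero of [F] of order [j > 0] is a zero of its derivative of order exactly
    [j - 1], the leading coefficient being multiplied by [j]. *)
Lemma factor_of_deriv (K : numFieldType) (t : K) (F H : {poly K}) e :
  (0 < e)%N -> F.[t] = 0 -> F^`() = ('X - t%:P) ^+ e.-1 * H ->
  exists2 h, F = ('X - t%:P) ^+ e * h & h.[t] *+ e = H.[t].
Proof.
move=> e0 Ft dF.
have Xn0 j : ('X - t%:P) ^+ j != 0 :> {poly K}.
  by rewrite expf_neq0 // polyXsubC_eq0.
have dX j (G : {poly K}) : (0 < j)%N -> (('X - t%:P) ^+ j * G)^`() =
    ('X - t%:P) ^+ j.-1 * (G *+ j + ('X - t%:P) * G^`()).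
  case: j => // j _; rewrite derivM deriv_XsubC_exp /= mulrDr mulrnAl mulrnAr.
  by rewrite mulrA -exprSr.
have [F0|F0] := eqVneq F 0.
  exists 0; first by rewrite mulr0.
  move/eqP: dF; rewrite F0 deriv0 eq_sym mulf_eq0 (negPf (Xn0 _)) /= => /eqP->.
  by rewrite horner0 mul0rn.
have [j [G /implyP/(_ F0) Gt FE]] := multiplicity_XsubC F t.
have j0 : (0 < j)%N.
  case: j FE => //; rewrite expr0 mulr1 => FE.
  by move: Gt; rewrite /root -FE Ft eqxx.
have ej : (e <= j)%N.
  rewrite leqNgt; apply/negP=> je; case/negP: Gt; rewrite /root.
  move: dF; rewrite FE mulrC dX //.
  have -> : e.-1 = (j.-1 + (e - j))%N by lia.
  rewrite exprD -mulrA => /(mulfI (Xn0 _)) /(congr1 (horner^~ t)).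
  rewrite !hornerE subrr mul0r addr0 expr0n.
  rewrite subn_eq0 leqNgt je mul0r => /eqP.
  by rewrite hornerMn mulrn_eq0 (gtn_eqF j0).
have [h FE'] : exists h, F = ('X - t%:P) ^+ e * h.
  by exists (('X - t%:P) ^+ (j - e) * G); rewrite mulrA -exprD subnKC // mulrC.
exists h => //; move: dF; rewrite FE' dX // => /(mulfI (Xn0 _)) <-.
by rewrite hornerD hornerMn hornerM hornerXsubC subrr mul0r addr0.
Qed.

Section Poly3.
Variable K : numFieldType.
Local Notation mp := (mpoly 3 K).
Local Notation space := 'rV[K]_3.
Implicit Types (P Q : mp) (u v x : space) (ws : seq space).

Definition dir v P : mp := \sum_i v 0 i *: mderiv i P.

Fact dir_is_linear v : linear (dir v).
Proof.
move=> a P Q; rewrite /dir scaler_sumr -big_split /=; apply: eq_bigr => i _.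
by rewrite linearP scalerDr !scalerA mulrC.
Qed.
HB.instance Definition _ v :=
  GRing.isLinear.Build K mp mp _ (dir v) (dir_is_linear v).

Lemma dirC u v P : dir u (dir v P) = dir v (dir u P).
Proof.
have expand a b : dir a (dir b P) =
    \sum_i \sum_j (a 0 i * b 0 j) *: mderiv i (mderiv j P).
  apply: eq_bigr => i _; rewrite {1}/dir (linear_sum (mderiv i)) scaler_sumr.
  by apply: eq_bigr => j _; rewrite linearZ /= scalerA.
rewrite !expand exchange_big; apply: eq_bigr => j _; apply: eq_bigr => i _ /=.
by rewrite mderiv_comm mulrC.
Qed.

Lemma dir_delta i P : dir (delta_mx 0 i) P = mderiv i P.
Proof.
rewrite /dir (bigD1 i) //= big1 ?addr0 ?mxE ?eqxx ?scale1r // => j ji.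
by rewrite mxE eqxx (negPf ji) scale0r.
Qed.

Lemma dir_sum (I : finType) (c : I -> K) (vs : I -> space) P :
  dir (\sum_j c j *: vs j) P = \sum_j c j *: dir (vs j) P.
Proof.
rewrite /dir; under [RHS]eq_bigr => j _ do rewrite scaler_sumr.
rewrite exchange_big; apply: eq_bigr => i _ /=.
rewrite summxE scaler_suml; apply: eq_bigr => j _.
by rewrite mxE scalerA.
Qed.

Definition dirs ws P := foldl (fun P v => dir v P) P ws.

Fact dirs_is_linear ws : linear (dirs ws).
Proof. by elim: ws => [|v ws IH] a P Q //=; rewrite linearP IH. Qed.
HB.instance Definition _ ws :=
  GRing.isLinear.Build K mp mp _ (dirs ws) (dirs_is_linear ws).

Lemma dirs_cat ws ws' P : dirs (ws ++ ws') P = dirs ws' (dirs ws P).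
Proof. exact: foldl_cat. Qed.

Lemma dirsC ws ws' P : dirs ws (dirs ws' P) = dirs ws' (dirs ws P).
Proof.
have dir_dirs v ws1 Q : dirs ws1 (dir v Q) = dir v (dirs ws1 Q).
  by elim: ws1 Q => //= w ws1 IH Q; rewrite dirC IH.
by elim: ws P => //= v ws IH P; rewrite -dir_dirs IH.
Qed.

Lemma dirs_perm ws ws' P : perm_eq ws ws' -> dirs ws P = dirs ws' P.
Proof.
elim: ws ws' P => [|v ws IH] ws' P.
  by rewrite perm_sym => /perm_nilP ->.
rewrite perm_sym => /perm_consP[i [ws'' [rotE perm]]].
rewrite -(cat_take_drop i ws') dirs_cat dirsC -dirs_cat -/(rot i ws') rotE /=.
by apply: IH; rewrite perm_sym.
Qed.

Definition evalp x P : K := meval (x 0) P.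
Fact evalp_is_linear x : linear_for *%R (evalp x).
Proof. by move=> a P Q; rewrite /evalp mevalD mevalZ. Qed.
HB.instance Definition _ x :=
  GRing.isLinear.Build K mp K _ (evalp x) (evalp_is_linear x).

Lemma evalpZ x a P : evalp x (a *: P) = a * evalp x P.
Proof. exact: mevalZ. Qed.

Definition vanish x r P := forall ws, (size ws < r)%N -> evalp x (dirs ws P) = 0.

Lemma vanish_leq x r r' P : (r <= r')%N -> vanish x r' P -> vanish x r P.
Proof. by move=> rr' vP ws /leq_trans/(_ rr')/vP. Qed.

Lemma vanish_dir x r v P : vanish x r.+1 P -> vanish x r (dir v P).
Proof. by move=> vP ws wr; apply: (vP (v :: ws)). Qed.

Lemma vanish_dirs x r ws P : vanish x r P -> vanish x (r - size ws) (dirs ws P).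
Proof.
move=> vP ws' h; rewrite -dirs_cat; apply: vP; rewrite size_cat.
by rewrite -ltn_subRL.
Qed.

(** Iterated derivatives are multilinear in the directions, so those along a basis suffice. *)
Lemma dirs_span x (M : 'M[K]_3) j P : row_full M ->
  (forall s : seq 'I_3, size s = j -> evalp x (dirs [seq row i M | i <- s] P) = 0) ->
  forall ws, size ws = j -> evalp x (dirs ws P) = 0.
Proof.
move=> fM; elim: j P => [|j IH] P hP.
  by move=> ws /size0nil ->; apply: (hP [::]).
move=> [|u ws] //= [wj]; have [c ->] : exists c : space, u = \sum_i c 0 i *: row i M.
  exists (u *m pinvmx M); rewrite -mulmx_sum_row mulmxKpV //.
  exact: submx_full.
rewrite (dir_sum (fun i => c 0 i)) linear_sum raddf_sum big1 //= => i _.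
rewrite linearZ /= evalpZ (IH (dir (row i M) P)) ?mulr0 // => s sj.
by apply: (hP (i :: s)); rewrite /= sj.
Qed.

Definition pullback (p : 'I_3 -> {poly K}) P : {poly K} := mmap (@polyC K) p P.

Fact pullback_is_linear p : linear (pullback p).
Proof. by move=> a P Q; rewrite /pullback mmapD mmapZ mul_polyC. Qed.
HB.instance Definition _ p :=
  GRing.isLinear.Build K mp {poly K} _ (pullback p) (pullback_is_linear p).

Lemma pullback_eval p P t : (pullback p P).[t] = evalp (\row_i (p i).[t]) P.
Proof.
rewrite /evalp /meval /pullback /mmap horner_sum; apply: eq_bigr => m _.
rewrite hornerM hornerC /mmap1 horner_prod; congr (_ * _); apply: eq_bigr => i _.
by rewrite horner_exp mxE.
Qed.

Lemma pullbackM p P Q : pullback p (P * Q) = pullback p P * pullback p Q.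
Proof. exact: (rmorphM (mmap (@polyC K) p)). Qed.

Lemma pullback_chain p P : (pullback p P)^`() = \sum_i (p i)^`() * pullback p (mderiv i P).
Proof.
pose ok P := (pullback p P)^`() = \sum_i (p i)^`() * pullback p (mderiv i P).
have okC c : ok (mpolyC 3 c).
  rewrite /ok /pullback mmapC derivC big1 // => i _.
  by rewrite mderivC mmap0 mulr0.
have okX i : ok (mpolyX K (mnm1 i)).
  rewrite /ok /pullback mmapX mmap1U (bigD1 i) //= big1.
    rewrite addr0 mderivX mnm1E eqxx scale1r.
    have -> : mnm_sub (mnm1 i) (mnm1 i) = mnm0 by apply/mnmP=> j; rewrite !mnmE subnn.
    by rewrite mpolyX0 mmapC mulr1.
  move=> j ji; rewrite mderivX mnm1E eq_sym (negPf ji) scale0r.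
  by rewrite mmap0 mulr0.
have okD P1 P2 : ok P1 -> ok P2 -> ok (P1 + P2).
  rewrite /ok linearD derivD => -> ->; rewrite -big_split /=.
  by apply: eq_bigr => i _; rewrite !linearD mulrDr.
have okM P1 P2 : ok P1 -> ok P2 -> ok (P1 * P2).
  rewrite /ok pullbackM derivM => -> ->.
  rewrite mulr_suml mulr_sumr -big_split /=; apply: eq_bigr => i _.
  rewrite mderivM linearD /= mulrDr; congr (_ + _).
    by rewrite pullbackM mulrA.
  by rewrite pullbackM mulrCA.
rewrite -/(ok P); elim/mpolyind: P => [|c m P _ _ okP].
  exact: (okC 0).
apply/okD => //; rewrite -mul_mpolyC; apply/okM => //.
rewrite mpolyXE_id; elim/big_rec: _ => [|i Q _ okQ]; first exact: (okC 1).
apply/okM => //; elim: (m i) => [|e IH]; first exact: (okC 1).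
by rewrite exprS; apply/okM.
Qed.

(* [pullback p P] vanishes at [t] to order exactly [m * r] if and only if the
   degree [r] part of [P] at [x] does not vanish in the direction [v]. *)
Lemma pullback_branch (p q : 'I_3 -> {poly K}) x v t m r P :
  (0 < m)%N -> (forall i, p i = (x 0 i)%:P + ('X - t%:P) ^+ m * q i) ->
  (forall i, v 0 i = (q i).[t]) -> vanish x r P ->
  exists2 h, pullback p P = ('X - t%:P) ^+ (m * r) * h &
    h.[t] *+ r`! = evalp x (dirs (nseq r v) P).
Proof.
move=> m0 pE vE.
have px : \row_i (p i).[t] = x.
  apply/rowP=> i; rewrite mxE pE !hornerE subrr expr0n gtn_eqF // mul0r addr0.
  by [].
elim: r P => [|r IH] P vP.
  by exists (pullback p P); rewrite ?muln0 ?mul1r // pullback_eval px.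
have /fin_all_exists2[h hE ht] i : exists2 h,
    pullback p (mderiv i P) = ('X - t%:P) ^+ (m * r) * h &
    h.[t] *+ r`! = evalp x (dirs (nseq r v) (mderiv i P)).
  by apply: IH; rewrite -dir_delta; apply: vanish_dir.
(* The bracket times [(X - t)^(m - 1)] is the derivative of [p i], so [H] is the cofactor given by
   the chain rule. *)
pose H := \sum_i (q i *+ m + ('X - t%:P) * (q i)^`()) * h i.
have Ht : H.[t] *+ r`! = evalp x (dirs (nseq r.+1 v) P) *+ m.
  rewrite /= /dir (linear_sum (dirs _)) (linear_sum (evalp x)) /H horner_sum -!sumrMnl.
  apply: eq_bigr => i _; rewrite hornerM hornerD hornerMn hornerM hornerXsubC.
  rewrite subrr mul0r addr0 -mulrnAr ht -vE mulrnAl.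
  by rewrite (linearZZ (dirs _)) /= evalpZ.
have [||| g gE gt] := @factor_of_deriv K t (pullback p P) H (m * r.+1).
- by rewrite muln_gt0 m0.
- by rewrite pullback_eval px; apply: (vP [::]).
- rewrite pullback_chain /H mulr_sumr; apply: eq_bigr => i _.
  rewrite hE pE derivD derivC add0r derivM deriv_XsubC_exp.
  have -> : (m * r.+1).-1 = (m.-1 + m * r)%N by lia.
  have -> : ('X - t%:P) ^+ m.-1 *+ m * q i + ('X - t%:P) ^+ m * (q i)^`() =
      ('X - t%:P) ^+ m.-1 * (q i *+ m + ('X - t%:P) * (q i)^`()).
    by rewrite mulrDr mulrnAl mulrnAr mulrA -exprSr prednK.
  by rewrite exprD mulrACA.
exists g => //; apply: (@mulIf _ (m%:R : K)).
  by rewrite pnatr_eq0 -lt0n.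
rewrite !mulr_natr -Ht -gt -!mulrnA; congr (_ *+ _).
by rewrite factS; lia.
Qed.

Definition box n P := forall m : multinom 3, (exists i, n <= m i)%N -> mcoeff m P = 0.

Lemma box_dir n v P : box n P -> box n (dir v P).
Proof.
move=> bP m [j nm]; rewrite /dir (linear_sum (mcoeff m)) big1 //= => i _.
rewrite mcoeffZ mcoeff_deriv bP ?mul0rn ?mulr0 //.
by exists j; rewrite mnmDE (leq_trans nm) ?leq_addr.
Qed.

Lemma box_dirs n ws P : box n P -> box n (dirs ws P).
Proof. by elim: ws P => //= v ws IH P bP; apply/IH/box_dir. Qed.

Lemma box_leq n n' P : (n <= n')%N -> box n P -> box n' P.
Proof. by move=> nn' bP m [i nm]; apply: bP; exists i; apply: leq_trans nm. Qed.

Lemma box_mulX n i c P : box n P ->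
  box n.+1 ((mpolyX K (mnm1 i) - mpolyC 3 c) * P).
Proof.
move=> bP m [j nm]; rewrite mulrBl mul_mpolyC mcoeffB mcoeffZ.
rewrite (bP m) ?mulr0 ?subr0; last by exists j; apply: ltnW.
rewrite {1}[P]mpolyE mulr_sumr (linear_sum (mcoeff m)) big_seq big1 //= => m' m'P.
rewrite -scalerAr -mpolyXD mcoeffZ mcoeffX; case: eqP => [defm|]; rewrite ?mulr0 //.
move: m'P; rewrite mcoeff_msupp bP ?eqxx //.
by exists j; move: nm; rewrite -defm mnmDE mnm1E; case: (i == j); lia.
Qed.

(* Differentiating along the leading monomial leaves a nonzero constant. *)
Lemma box_vanish_eq0 n x P : box n P -> vanish x (3 * n) P -> P = 0.
Proof.
move=> bP vP; apply/eqP; apply: contraT => P0; pose m := mlead P.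
have Pm : mcoeff m P != 0 by rewrite mleadc_eq0.
have mn i : (m i < n)%N.
  by rewrite ltnNge; apply: contra Pm => nm; rewrite bP //; exists i.
have mn3 : (mdeg m < 3 * n)%N.
  rewrite mdegE !big_ord_recl big_ord0.
  have := mn ord0; have := mn (lift ord0 ord0).
  have := mn (lift ord0 (lift ord0 ord0)); lia.
suff : evalp x (mderivm m P) = 0.
  have -> : mderivm m P = mpolyC 3 (mcoeff m P *+ \prod_(i < 3) (m i)`!).
    apply/mpolyP=> k; rewrite mcoeff_mderivm mcoeffC.
    case: eqP => [->|/eqP k0].
      have -> : mnm_add m mnm0 = m by apply/mnmP=> i; rewrite mnmDE mnm0E addn0.
      by rewrite mulr1; under eq_bigr => i _ do rewrite ffactnn.
    rewrite mulr0 mcoeff_gt_mlead ?mul0rn // lt_mdeg_ltmc // mdegD -addn1 leq_add2l.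
    by rewrite lt0n mdeg_eq0.
  rewrite /evalp mevalC => /eqP; rewrite mulrn_eq0 (negPf Pm) orbF => /eqP p0.
  suff : (0 < \prod_(i < 3) (m i)`!)%N by rewrite p0.
  by apply: prodn_gt0 => i; rewrite fact_gt0.
rewrite mderivm_foldr; set s := flatten _.
have ss : size s = mdeg m.
  rewrite size_flatten /shape -map_comp mdegE sumnE big_map enumT.
  by apply: eq_bigr => i _; rewrite /= size_nseq.
have -> : foldr (@mderiv 3 K) P s = dirs (rev [seq delta_mx 0 i | i <- s]) P.
  by elim: (s) => //= i s' ->; rewrite rev_cons -cats1 dirs_cat /= dir_delta.
by apply: vP; rewrite size_rev size_map ss.
Qed.

Lemma pullback_size n B (p : 'I_3 -> {poly K}) P :
  box n P -> (forall i, size (p i) <= B.+1)%N ->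
  (size (pullback p P) <= 3 * B * n + 1)%N.
Proof.
move=> bP pB; rewrite /pullback /mmap big_seq.
apply: (big_ind (fun q : {poly K} => (size q <= 3 * B * n + 1)%N)).
- by rewrite size_poly0.
- by move=> q q' h h'; apply: leq_trans (size_polyD _ _) _; rewrite geq_max h.
move=> m mP; have mn i : (m i < n)%N.
  by rewrite ltnNge; apply: contraL mP => nm; rewrite mcoeff_msupp negbK bP //; exists i.
have pm i : (size (p i ^+ m i) <= (B * n).+1)%N.
  apply: leq_trans (size_poly_exp_leq _ _) _; rewrite ltnS.
  by apply: leq_mul (ltnW (mn i)); have := pB i; lia.
rewrite mul_polyC; apply: leq_trans (size_scale_leq _ _) _.
rewrite /mmap1 !big_ord_recl big_ord0 mulr1.
have sizeM a b (q q' : {poly K}) : (size q <= a.+1)%N -> (size q' <= b.+1)%N ->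
    (size (q * q')%R <= (a + b).+1)%N.
  by move=> qa qb; apply: leq_trans (size_polyMleq _ _) _; lia.
rewrite -mulnA mulSn mulSn mul1n addn1.
by apply/sizeM; [|apply/sizeM]; apply: pm.
Qed.

(** * The finite-dimensional space of polynomials of bounded degree in each variable *)

Section Ambient.
Variable n : nat.
(** Tables of coefficients form a [vectType] of evident dimension; [box_poly] and [box_coefs] pass
    to polynomials and back. *)
Definition polybox := {ffun {ffun 'I_3 -> 'I_n} -> K^o}.
HB.instance Definition _ := Vector.on polybox.
Implicit Types (q : polybox).

Definition box_mon (f : {ffun 'I_3 -> 'I_n}) : multinom 3 :=
  Multinom [tuple (f i : nat) | i < 3].

Lemma box_monE f i : box_mon f i = f i.
Proof. exact: mnmE. Qed.

Lemma box_mon_inj : injective box_mon.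
Proof.
move=> f g /mnmP fg; apply/ffunP=> i; apply/val_inj.
by have := fg i; rewrite !box_monE.
Qed.

Definition box_poly q : mp := \sum_f (q f : K) *: mpolyX K (box_mon f).
Definition box_coefs P : polybox := [ffun f => mcoeff (box_mon f) P].

Fact box_poly_is_linear : linear box_poly.
Proof.
move=> a q q'; rewrite /box_poly scaler_sumr -big_split /=; apply: eq_bigr => f _.
by rewrite !ffunE scalerDl scalerA.
Qed.
HB.instance Definition _ :=
  GRing.isLinear.Build K polybox mp _ box_poly box_poly_is_linear.

Fact box_coefs_is_linear : linear box_coefs.
Proof. by move=> a P Q; apply/ffunP=> f; rewrite !ffunE mcoeffD mcoeffZ. Qed.
HB.instance Definition _ :=
  GRing.isLinear.Build K mp polybox _ box_coefs box_coefs_is_linear.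

Lemma box_poly_box q : box n (box_poly q).
Proof.
move=> m [i nm]; rewrite /box_poly (linear_sum (mcoeff m)) big1 //= => f _.
rewrite mcoeffZ mcoeffX; case: eqP => [defm|]; rewrite ?mulr0 //.
by move: nm; rewrite -defm box_monE leqNgt ltn_ord.
Qed.

Lemma mcoeff_box_poly q f : mcoeff (box_mon f) (box_poly q) = q f.
Proof.
rewrite /box_poly (linear_sum (mcoeff _)) (bigD1 f) //= big1 => [|g gf].
  by rewrite mcoeffZ mcoeffX eqxx mulr1 addr0.
by rewrite mcoeffZ mcoeffX (inj_eq box_mon_inj) (negPf gf) mulr0.
Qed.

Lemma box_polyK : cancel box_poly box_coefs.
Proof. by move=> q; apply/ffunP=> f; rewrite ffunE mcoeff_box_poly. Qed.

Lemma box_coefsK P : box n P -> box_poly (box_coefs P) = P.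
Proof.
move=> bP; apply/mpolyP=> m.
have [/forallP mn|] := boolP [forall i, (m i < n)%N].
  have -> : m = box_mon [ffun i => Ordinal (mn i)].
    by apply/mnmP=> i; rewrite box_monE ffunE.
  by rewrite mcoeff_box_poly ffunE.
rewrite negb_forall => /existsP[i]; rewrite -leqNgt => nm.
by rewrite bP; [rewrite box_poly_box //|]; exists i.
Qed.

Lemma dim_polybox : \dim {:polybox} = (n ^ 3)%N.
Proof. by rewrite dimvf /dim /= muln1 card_ffun !card_ord. Qed.

Definition jet x ws q : K^o := evalp x (dirs ws (box_poly q)).
Fact jet_is_linear x ws : linear (jet x ws).
Proof. by move=> a q q'; rewrite /jet !linearP. Qed.
HB.instance Definition _ x ws :=
  GRing.isLinear.Build K polybox K^o _ (jet x ws) (jet_is_linear x ws).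

(** Only derivatives along coordinate vectors are imposed, to keep the intersection finite. *)
Definition vanishing x r : {vspace polybox} :=
  (\bigcap_(j < r) \bigcap_(s : j.-tuple 'I_3)
     lker (linfun (jet x [seq delta_mx 0%R i | i <- s])))%VS.

Lemma vanishingP x r q : reflect (vanish x r (box_poly q)) (q \in vanishing x r).
Proof.
apply: (iffP idP).
  rewrite memvE => /subv_bigcapP qO ws wr.
  apply: (@dirs_span x 1%:M (size ws)) => //; first by rewrite row_full_unit unitmx1.
  move=> s sw; move: (qO (Ordinal wr) isT) => /subv_bigcapP.
  move=> /(_ (Tuple (introT eqP sw)) isT); rewrite -memvE memv_ker lfunE /=.
  by move/eqP; rewrite /jet; under eq_map => i do rewrite -row1.
move=> vq; rewrite memvE; apply/subv_bigcapP=> j _; apply/subv_bigcapP=> s _.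
by rewrite -memvE memv_ker lfunE /= /jet vq // size_map size_tuple.
Qed.

End Ambient.
End Poly3.

(** * Points on polynomial curves *)

Section VanishM.
Variable K : numFieldType.
Local Notation mp := (mpoly 3 K).
Local Notation space := 'rV[K]_3.
Implicit Types (P f : mp) (v x : space) (ws : seq space).

Lemma dirM v f P : dir v (f * P) = dir v f * P + f * dir v P.
Proof.
rewrite /dir mulr_suml mulr_sumr -big_split /=; apply: eq_bigr => i _.
by rewrite mderivM scalerDr scalerAl scalerAr.
Qed.

Lemma evalpM x f P : evalp x (f * P) = evalp x f * evalp x P.
Proof. exact: (rmorphM (meval (x 0))). Qed.

Lemma vanishD x r P f : vanish x r P -> vanish x r f -> vanish x r (P + f).
Proof. by move=> vP vf ws wr; rewrite !linearD /= vP ?vf ?addr0. Qed.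

(** By the Leibniz rule. With [vanishM_incr] and [vanishM_reflect], this supplies the three
    hypotheses on [phi] of the handicap argument. *)
Lemma vanishM x r f P : vanish x r P -> vanish x r (f * P).
Proof.
elim: r f P => [|r IH] f P vP [|v ws] //= wr.
  by rewrite evalpM (vP [::]) ?mulr0.
rewrite dirM; apply: (vanishD (r := r)) => //; apply: IH.
  exact: vanish_leq vP.
exact: vanish_dir.
Qed.

Lemma vanishM_incr x r f P : evalp x f = 0 -> vanish x r P -> vanish x r.+1 (f * P).
Proof.
move=> f0; elim: r P => [|r IH] P vP [|v ws] //= wr; rewrite ?evalpM ?f0 ?mul0r //.
rewrite dirM; apply: (vanishD (r := r.+1)) => //; first exact: vanishM.
exact/IH/vanish_dir.
Qed.

(** In the Leibniz expansion, a term in which [f] is differentiated leaves fewer than [size ws]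
    derivatives for [P]. *)
Lemma evalp_dirsM x ws f P : vanish x (size ws) P ->
  evalp x (dirs ws (f * P)) = evalp x f * evalp x (dirs ws P).
Proof.
elim: ws P => [|v ws IH] P vP /=; first exact: evalpM.
rewrite dirM !linearD /= (vanishM (dir v f) vP) ?add0r //.
by rewrite IH //; apply: vanish_dir.
Qed.

Lemma vanishM_reflect x r f P : evalp x f != 0 -> vanish x r (f * P) -> vanish x r P.
Proof.
move=> f0; elim: r => [|r IH] vfP // ws; rewrite ltnS leq_eqVlt => /orP[/eqP wr|].
  have vP : vanish x (size ws) P by rewrite wr; apply/IH/(vanish_leq _ vfP).
  have := vfP ws; rewrite wr evalp_dirsM // => /(_ (ltnSn _))/eqP.
  by rewrite mulf_eq0 (negPf f0) => /eqP.
by apply: IH; apply: vanish_leq vfP.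
Qed.

Lemma evalp_coord x i c : evalp x (mpolyX K (mnm1 i) - mpolyC 3 c) = x 0 i - c.
Proof. by rewrite /evalp mevalB mevalXU mevalC. Qed.

End VanishM.

(* [v] is the first nonzero derivative of [p] at [t], up to a factorial (or [0],
   if [m] is not maximal). *)
Definition branch (K : numFieldType) (p : 'I_3 -> {poly K}) (x v : 'rV[K]_3) :=
  exists t m (q : 'I_3 -> {poly K}),
    [/\ (0 < m)%N, forall i, p i = (x 0 i)%:P + ('X - t%:P) ^+ m * q i &
        forall i, v 0 i = (q i).[t]].

(** * Weights of points and active steps along curves *)

Section JointWeights.
Variables (K : realFieldType) (k n : nat) (X : 'I_k -> 'rV[K]_3).
Local Notation mp := (mpoly 3 K).
Local Notation space := 'rV[K]_3.
Local Notation E := (polybox K n).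
Local Notation O := (fun x r => vanishing n (X x) r).
Implicit Types (b : 'I_k -> nat) (x y : 'I_k) (v : space).

Fact vanishing0 x : O x 0 = fullv.
Proof. by apply/vspaceP=> q; rewrite memvf; apply/vanishingP. Qed.

Fact vanishingS x r : (O x r.+1 <= O x r)%VS.
Proof.
apply/subvP=> q /vanishingP vq; apply/vanishingP.
exact: vanish_leq vq.
Qed.

Fact vanishingN x : O x (3 * n) = 0%VS.
Proof.
apply/eqP; rewrite -subv0; apply/subvP=> q /vanishingP vq; rewrite memv0.
by rewrite -[q]box_polyK (box_vanish_eq0 (box_poly_box q) vq) linear0.
Qed.

Lemma admissible_vanish b t q :
  reflect (forall y, vanish (X y) (nconds b t y) (box_poly q)) (q \in admissible O b t).
Proof.
apply: (iffP (admissibleP _ _ _ _)) => h y; first exact/vanishingP/h.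
exact/vanishingP.
Qed.

(** The guard discards the rounds before the first condition at [x], where the truncated difference
    [s - b x] would pass for order 0. *)
Definition active b x (s : nat) v := (b x <= s)%N &&
  ~~ (admissible O b (s * k + x) <=
      lker (linfun (jet (n := n) (X x) (nseq (s - b x) v))))%VS.

Lemma inactive_dirs b x s i ws v P : (i + b x + size ws = s)%N ->
  ~~ active b x (i + b x) v -> box n P ->
  (forall y, vanish (X y) (nconds b (s * k + x) y) P) ->
  evalp (X x) (dirs (ws ++ nseq i v) P) = 0.
Proof.
move=> sE; rewrite /active leq_addl /= negbK addnK => /subvP kerA bP vP.
have bQ := box_dirs ws bP.
rewrite dirs_cat -(box_coefsK bQ).
suff /kerA : box_coefs n (dirs ws P) \in admissible O b ((i + b x) * k + x).
  by rewrite memv_ker lfunE /= => /eqP.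
apply/admissible_vanish=> y; rewrite box_coefsK //.
(* Going back [size ws] rounds lowers all required orders by [size ws], just as differentiating
   along [ws] does. *)
have -> : nconds b ((i + b x) * k + x) y =
    (nconds b (s * k + x) y - size ws)%N.
  have kx := ltn_ord x; rewrite -sE (mulnDl _ (size ws)) /nconds.
  have -> : ((i + b x) * k + size ws * k + x + (k.-1 - y) =
    size ws * k + ((i + b x) * k + x + (k.-1 - y)))%N by lia.
  by rewrite divnMDl; lia.
exact: vanish_dirs.
Qed.

Lemma eq_perm (T : eqType) (s s' : seq T) : s = s' -> perm_eq s s'.
Proof. by move->. Qed.

Lemma perm_flatten_count (I : finType) (a : seq I) :
  perm_eq a (flatten [seq nseq (count_mem i a) i | i <- enum I]).
Proof.
apply/allP=> e _ /=; apply/eqP; rewrite count_flatten -map_comp sumnE big_map.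
rewrite big_enum /= (bigD1 e) //= count_nseq /= eqxx mul1n big1 ?addn0 // => i ie.
by rewrite count_nseq /= (negPf ie).
Qed.

(* If the [i]-th derivative along [v] kills the polynomials surviving until the
   condition of order [i], then all mixed derivatives of order [r >= i] involving
   [v] at least [i] times kill those surviving until the condition of order [r]:
   the remaining derivatives map the latter polynomials to the former. *)
Lemma weight_le b T x (M : 'M[K]_3) : row_free M ->
  (weight O fullv b T x <=
     \prod_(i < 3) #|[set s : 'I_T | active b x s (row i M)]|)%N.
Proof.
move=> fM; rewrite (weightE vanishingS).
pose R i := [set s : 'I_T | active b x s (row i M)].
pose A := [set a : {ffun 'I_3 -> 'I_T} | [forall i, a i \in R i]].
(* A triple [a] stands for the mixed derivative of order [a i - b x] along each row [i]; [tot a] is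
   the round testing its total order. *)
pose tot (a : {ffun 'I_3 -> 'I_T}) := (\sum_i (a i - b x) + b x)%N.
pose w (c : 'I_3 -> nat) := flatten [seq nseq (c i) (row i M) | i <- enum 'I_3].
have term (s : 'I_T) :
    (\dim ((fullv :&: admissible O b (s * k + x)) :\: O x (s.+1 - b x)%N) <=
     #|[set a in A | tot a == s]|)%N.
  have [sb|bs] := ltnP s (b x).
    have -> : (s.+1 - b x = 0)%N by lia.
    by rewrite dimv_diff vanishing0 capvf subnn.
  pose f (a : {ffun 'I_3 -> 'I_T}) :=
    linfun (jet (n := n) (X x) (w (fun i => a i - b x)%N)).
  apply: (@dimv_diff_le_card _ _ _ _ f) => q.
  rewrite memv_cap memvf => /admissible_vanish qU qf; apply/vanishingP.
  have vP := qU x; rewrite nconds_eq in vP.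
  move=> ws; rewrite subSn // ltnS leq_eqVlt => /orP[/eqP wr|]; last exact: vP.
  apply: (dirs_span (M := M) (j := (s - b x)%N)) wr.
    by rewrite row_full_unit -row_free_unit.
  move=> a sa; pose c i := count_mem i a.
  have cle i : (c i + b x < T)%N.
    apply: leq_ltn_trans (ltn_ord s).
    by have := count_size (pred1 i) a; rewrite sa /c; lia.
  (* If every row is active at its multiplicity, the derivative is one of those assumed to vanish;
     otherwise [inactive_dirs] applies to an inactive row. *)
  have [/forallP act|] := boolP [forall i, active b x (c i + b x) (row i M)].
    pose a0 := [ffun i => Ordinal (cle i)] : {ffun 'I_3 -> 'I_T}.
    have a0P : a0 \in [set a in A | tot a == s].
      rewrite !inE; apply/andP; split.
        by apply/forallP=> i; rewrite ffunE inE act.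
      rewrite /tot; under eq_bigr => i _ do rewrite ffunE /= addnK.
      have := perm_size (perm_flatten_count a); rewrite sa size_flatten /shape.
      rewrite -map_comp sumnE big_map big_enum /=.
      under eq_bigr => i _ do rewrite size_nseq.
      by rewrite /c => <-; rewrite subnK.
    have := qf a0 a0P; rewrite lfunE /= /jet.
    rewrite (@dirs_perm _ _ [seq row i M | i <- a]) //.
    rewrite perm_sym (perm_trans (perm_map _ (perm_flatten_count a))) //.
    rewrite map_flatten -map_comp; apply: eq_perm; congr flatten.
    by apply: eq_map => i /=; rewrite map_nseq ffunE /= addnK.
  rewrite negb_forall => /existsP[i na].
  have pa : perm_eq a (seq.filter (predC1 i) a ++ nseq (c i) i).
    rewrite perm_sym perm_catC; apply: perm_trans (permEl (perm_filterC (pred1 i) a)).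
    rewrite perm_cat2r; apply: eq_perm.
    by rewrite /c; elim: (a) => //= e a' IH; case: eqP => [->|_]; rewrite ?add1n ?add0n /= IH.
  rewrite (dirs_perm _ (perm_map _ pa)) map_cat map_nseq.
  apply: (inactive_dirs (s := s)) na _ _ => //; last exact: box_poly_box.
  by rewrite size_map size_filter addnAC /c count_predC sa subnK.
apply: (@leq_trans (\sum_(s < T) #|[set a in A | tot a == s]|)%N).
  by apply: leq_sum => s _; apply: term.
have -> : (\prod_(i < 3) #|R i| = #|A|)%N.
  have -> : #|A| = #|family R|.
    by apply: eq_card => a; rewrite inE; apply/forallP/familyP.
  by rewrite card_family foldrE big_map big_enum.
rewrite -[leqRHS]sum1_card.
have -> : (\sum_(s < T) #|[set a in A | tot a == s]| =
    \sum_(s < T) \sum_(a in A | tot a == s) 1)%N.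
  by apply: eq_bigr => s _; rewrite -sum1_card; apply: eq_bigl => a; rewrite inE.
rewrite (exchange_big_dep (mem A)) /=; last by move=> s a _ /andP[].
apply: leq_sum => a aA; rewrite sum1_card.
apply: leq_trans (_ : #|[pred s : 'I_T | s == tot a :> nat]| <= _)%N.
  by apply: subset_leq_card; apply/fintype.subsetP=> s; rewrite !inE => /andP[_ /eqP->].
apply/card_le1P => s; rewrite inE => /eqP st s'; rewrite !inE.
by rewrite -val_eqE /= st.
Qed.

Definition active_steps b T (p : 'I_3 -> {poly K}) x : {set 'I_T} :=
  [set s : 'I_T | `[< exists2 v, branch p (X x) v & active b x s v >]].

(* Each active step makes the image of the surviving polynomials under the
   pull-back to the parameter line drop strictly. *)
Lemma sum_active_steps B b T (p : 'I_3 -> {poly K}) :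
  (forall i, size (p i) <= B.+1)%N ->
  (\sum_x #|active_steps b T p x| <= 3 * B * n + 1)%N.
Proof.
move=> pB; pose m := (3 * B * n + 1)%N.
pose g (q : E) : 'rV[K]_m := poly_rV (pullback p (box_poly q)).
have gP : linear (g : E -> 'rV[K]_m) by move=> a q q'; rewrite /g !linearP.
pose gL := GRing.isLinear.Build K E 'rV[K]_m _ g gP.
pose g' : {linear E -> 'rV[K]_m} := HB.pack g gL.
pose G t := (linfun g' @: admissible O b t)%VS.
have G_leq t t' : (t <= t')%N -> (G t' <= G t)%VS.
  by move=> tt'; apply/limgS/(admissible_leq vanishingS).
have d_leq t t' : (t <= t')%N -> (\dim (G t') <= \dim (G t))%N.
  by move=> tt'; apply/dimvS/G_leq.
apply: (@leq_trans (\dim (G 0%N))); last first.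
  by apply: leq_trans (dimvS (subvf _)) _; rewrite dimvf /dim /= mul1n.
apply: leq_trans (leq_subr (\dim (G (T * k)%N)) _).
rewrite -(sum_decrements_mod k T d_leq); apply: leq_sum => x _.
rewrite -sum1_card big_mkcond /=; apply: leq_sum => s _; rewrite inE.
case: asboolP => // -[v [t [j [q [j0 pE vE]]]] /andP[bs]].
set A := admissible _ _ _ => act; rewrite subn_gt0.
rewrite ltn_neqAle d_leq // andbT; apply/negP=> /eqP dE; case/negP: act.
apply/subvP=> P PA; rewrite memv_ker lfunE /=.
(* Without a drop, [P] has the same pull-back as some [P'] surviving the step. That pull-back has an
   additional zero of order [j] at [t], which kills the derivative of [P]. *)
have GE : G (s * k + x).+1 = G (s * k + x)%N.
  by apply/eqP; rewrite eqEdim G_leq // dE leqnn.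
have : linfun g' P \in G (s * k + x).+1 by rewrite GE memv_img.
case/memv_imgP=> P' P'A; rewrite !(lfunE g') => /(congr1 rVpoly).
rewrite /g !poly_rV_K; try by apply: pullback_size => //; apply: box_poly_box.
move=> PP'.
have := elimT (admissible_vanish _ _ _) P'A x; rewrite nconds_step eqxx subSn //.
have := elimT (admissible_vanish _ _ _) PA x; rewrite nconds_eq.
move=> /(pullback_branch j0 pE vE)[h hE ht] /(pullback_branch j0 pE vE)[h' h'E _].
move: PP'; rewrite hE h'E mulnS addnC exprD -mulrA.
move=> /mulfI; rewrite expf_neq0 ?polyXsubC_eq0 // => /(_ isT) hh'.
rewrite /jet -ht hh' hornerM horner_exp hornerXsubC subrr expr0n.
by rewrite gtn_eqF // mul0r mul0rn.
Qed.

End JointWeights.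

(** A product, over the other points [X y], of linear factors [X_i - X y 0 i], with [i] a coordinate
    in which [X y] and [X x] differ. *)
Lemma separating_poly (K : numFieldType) k (X : 'I_k -> 'rV[K]_3) x : injective X ->
  exists g : mpoly 3 K, [/\ evalp (X x) g != 0,
    forall y, y != x -> evalp (X y) g = 0 &
    forall n P, box n P -> box (n + k) (g * P)].
Proof.
move=> injX.
have sep y : {i : 'I_3 | y != x -> X x 0 i != X y 0 i}.
  apply: cid; have [->|yx] := eqVneq y x; first by exists 0.
  have : X x != X y by rewrite (inj_eq injX) eq_sym.
  case: (pickP (fun i => X x 0 i != X y 0 i)) => [i h _|h]; first by exists i.
  by case/eqP; apply/rowP=> i; apply/eqP; have := h i; case: eqP.
pose l y : mpoly 3 K := mpolyX K (mnm1 (sval (sep y))) - mpolyC 3 (X y 0 (sval (sep y))).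
pose r := [seq y <- enum 'I_k | y != x].
have evP z : evalp (X z) (\prod_(y <- r) l y) = \prod_(y <- r) evalp (X z) (l y).
  elim: (r) => [|y r' IH]; first by rewrite !big_nil /evalp meval1.
  by rewrite !big_cons evalpM IH.
exists (\prod_(y <- r) l y); split.
- rewrite evP prodf_seq_neq0; apply/allP=> y; rewrite mem_filter => /andP[yx _].
  by rewrite evalp_coord subr_eq0; apply: (svalP (sep y)).
- move=> y yx; rewrite evP (big_rem y) /=; last by rewrite mem_filter yx mem_enum.
  by rewrite evalp_coord subrr mul0r.
move=> n P bP; apply: (@box_leq _ (n + size r)).
  by rewrite leq_add2l size_filter (leq_trans (count_size _ _)) // size_enum_ord.
elim: (r) => [|y r' IH]; first by rewrite big_nil mul1r addn0.
by rewrite big_cons -mulrA addnS; apply: box_mulX.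
Qed.

(** [E0] is the space of polynomials of degree below [n'] in each variable, whose codimension is the
    loss per point; [S l x] counts the steps active at [X x] along curve [l]. *)
Theorem joint_weights (K : realFieldType) (k L B n' : nat)
    (X : 'I_k -> 'rV[K]_3) (p : 'I_L -> 'I_3 -> {poly K}) (w : 'I_k -> K)
    (n := (n' + k)%N) :
  injective X -> (forall l i, size (p l i) <= B.+1)%N -> (forall x, 0 <= w x) ->
  \sum_x (w x + (n ^ 3 - n' ^ 3)%:R) < (n ^ 3)%:R ->
  exists S : 'I_L -> 'I_k -> nat,
    (forall l, \sum_x S l x <= 3 * B * n + 1)%N /\
    forall x (l : 'I_3 -> 'I_L) (M : 'M[K]_3), row_free M ->
      (forall i, branch (p (l i)) (X x) (row i M)) ->
      w x <= (\prod_i S (l i) x)%:R.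
Proof.
move=> injX pB w0 wn.
have /choice[g /all_and3[gx gy gbox]] x := separating_poly x injX.
pose phi x (q : polybox K n) : polybox K n := box_coefs n (g x * box_poly q).
have phiP x : linear (phi x).
  by move=> a q q'; rewrite /phi linearP mulrDr -scalerAr linearP.
pose phiL x := GRing.isLinear.Build K (polybox K n) (polybox K n) _ (phi x) (phiP x).
pose phi' x : {linear polybox K n -> polybox K n} := HB.pack (phi x) (phiL x).
pose emb (q : polybox K n') : polybox K n := box_coefs n (box_poly q).
have embP : linear emb by move=> a q q'; rewrite /emb !linearP.
pose embL := GRing.isLinear.Build K (polybox K n') (polybox K n) _ emb embP.
pose emb' : {linear polybox K n' -> polybox K n} := HB.pack emb embL.
pose E0 := limg (linfun emb').
have n'n : (n' <= n)%N by rewrite leq_addr.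
have E0box u : u \in E0 -> box n' (box_poly u).
  case/memv_imgP=> q _ ->; rewrite (lfunE emb') /= /emb box_coefsK.
    exact: box_poly_box.
  exact: box_leq (box_poly_box q).
have dimE0 : \dim E0 = (n' ^ 3)%N.
  rewrite limg_dim_eq ?dim_polybox //; apply/eqP; rewrite capfv -subv0.
  apply/subvP=> q; rewrite memv_ker (lfunE emb') /= memv0 => /eqP q0.
  rewrite -[q]box_polyK -(@box_coefsK _ n (box_poly q)).
    by rewrite -/(emb q) q0 !linear0.
  exact: box_leq (box_poly_box q).
have phiE x u : u \in E0 -> box_poly (linfun (phi' x) u) = g x * box_poly u.
  by move=> /E0box uE; rewrite (lfunE (phi' x)) /= /phi box_coefsK //; apply: gbox.
have [|||| b [T wW]] := @handicaps_exist K (polybox K n) k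
  (fun x r => vanishing n (X x) r) (@vanishing0 K k n X) (@vanishingS K k n X)
  (3 * n) (@vanishingN K k n X) E0 (fun x => linfun (phi' x)) _ _ _ K w w0.
- move=> x u r u0 /vanishingP vu; apply/vanishingP; rewrite phiE //.
  exact: vanishM.
- move=> x y u r yx u0 /vanishingP vu; apply/vanishingP; rewrite phiE //.
  by apply: vanishM_incr => //; apply: gy.
- move=> x u r u0 /vanishingP; rewrite phiE // => vu; apply/vanishingP.
  exact: vanishM_reflect vu.
- by rewrite dim_polybox dimE0.
exists (fun l x => #|@active_steps K k n X b T (p l) x|); split=> [l|].
  exact: sum_active_steps.
move=> x l M fM brM; apply: le_trans (wW x) _; rewrite ler_nat.
apply: leq_trans (@weight_le K k n X b T x M fM) _; apply: leq_prod => i _.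
apply: subset_leq_card; apply/fintype.subsetP=> s; rewrite !inE => act.
by exists (row i M).
Qed.

(** * Preimages, roots and branches of polynomial parametrisations *)

Lemma poly_preimage_bounded (K : realFieldType) (p : {poly K}) (M : K) :
  (1 < size p)%N -> exists C, forall t, `|p.[t]| <= M -> `|t| <= C.
Proof.
elim/poly_ind: p M => [|p c IH] M; first by rewrite size_poly0.
have bnd t : `|(p * 'X + c%:P).[t]| <= M -> `|p.[t]| * `|t| <= M + `|c|.
  rewrite !hornerE -normrM => h.
  have -> : p.[t] * t = (p.[t] * t + c) - c by rewrite addrK.
  by apply: le_trans (ler_normB _ _) _; rewrite lerD2r.
have [p1|p1] := ltnP 1 (size p).
  have [C hC] := IH (M + `|c|) p1 => _; exists (Num.max 1 C) => t /bnd h.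
  rewrite le_max; have [//|t1] := leP `|t| 1; rewrite hC ?orbT //.
  apply: le_trans h; rewrite ler_peMr //; exact: ltW.
have [a pa] : exists a, p = a%:P by exists p`_0; apply: size1_polyC.
rewrite pa size_MXaddC polyC_eq0; case: eqP => [->|/eqP a0 _].
  by rewrite /= size_polyC; case: (c == 0); rewrite ?eqxx.
exists ((M + `|c|) / `|a|) => t; rewrite -pa => /bnd.
by rewrite pa hornerC ler_pdivlMr ?normr_gt0 // mulrC.
Qed.

Lemma poly_roots_seq (K : fieldType) (p : {poly K}) : p != 0 ->
  exists2 s : seq K, (size s < size p)%N & forall t, root p t -> t \in s.
Proof.
move: {2}(size p) (leqnn (size p)) => m; elim: m p => [|m IH] p.
  by rewrite leqn0 size_poly_eq0 => ->.
move=> pm p0; have [[t rt]|nr] := pselect (exists t, root p t); last first.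
  by exists [::]; [rewrite size_poly_gt0|move=> t rt; case: nr; exists t].
case/factor_theorem: (rt) => q pE.
have q0 : q != 0 by apply: contraNneq p0 => q0; rewrite pE q0 mul0r.
have sp : size p = (size q).+1 by rewrite pE size_Mmonic ?monicXsubC // size_XsubC addn2.
have [|s ss rs] := IH q _ q0; first by rewrite -ltnS -sp.
exists (t :: s) => [|u]; first by rewrite sp.
rewrite pE rootM root_XsubC inE => /orP[/rs->|->//]; exact: orbT.
Qed.

(** Take [m] maximal with [(X - t)^m] dividing all [p i - p i(t)]; a nonconstant coordinate bounds
    it. *)
Lemma branch_exists (K : fieldType) (p : 'I_3 -> {poly K}) (t : K) :
  (exists i, 1 < size (p i))%N ->
  exists m (q : 'I_3 -> {poly K}), [/\ (0 < m)%N,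
    forall i, p i = (p i).[t]%:P + ('X - t%:P) ^+ m * q i &
    exists i, (q i).[t] != 0].
Proof.
move=> [i0 pi0]; pose F i := p i - (p i).[t]%:P.
pose P m := [forall i, ('X - t%:P) ^+ m %| F i].
have Fi0 : F i0 != 0.
  rewrite subr_eq0; apply: contraTneq pi0 => ->.
  by rewrite -leqNgt size_polyC leq_b1.
have P1 : P 1%N.
  by apply/forallP=> i; rewrite expr1 dvdp_XsubCl /root !hornerE subrr.
have bP m : P m -> (m <= size (F i0))%N.
  move=> /forallP/(_ i0)/(dvdp_leq Fi0); rewrite size_exp_XsubC; exact: ltnW.
have exP : exists m, P m by exists 1%N.
case: (ex_maxnP exP bP) => m /forallP Pm maxm.
exists m, (fun i => F i %/ ('X - t%:P) ^+ m); split; first exact: maxm.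
  by move=> i; rewrite mulrC divpK // addrC subrK.
apply/existsP; apply: contraT; rewrite negb_exists => /forallP h.
suff /maxm : P m.+1 by rewrite ltnn.
apply/forallP=> i; rewrite -(divpK (Pm i)) exprSr mulrC.
by rewrite dvdp_mul2r ?expf_neq0 ?polyXsubC_eq0 // dvdp_XsubCl; have := h i; rewrite negbK.
Qed.

(** * Tangent lines of polynomial curves *)

Local Open Scope classical_set_scope.
Local Open Scope ring_scope.

Lemma near_cvg_to (T : Type) (U : topologicalType) (F : set_system T)
    {FF : Filter F} (f g : T -> U) (l : U) :
  (\forall s \near F, g s = f s) -> f @ F --> l -> g @ F --> l.
Proof.
move=> fg fl; apply: cvg_trans fl; apply: near_eq_cvg.
by apply: filterS fg => s ->.
Qed.

Section Tangent.
Variable R : realType.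
Local Notation space := 'rV[R]_3.
Implicit Types (p q : 'I_3 -> {poly R}) (x v d : space).

Definition curve p : set space := range (fun t : R => \row_i (p i).[t]).

(** No continuity of [tau] is assumed: compactness of [[-K, K]] gives a cluster value at 0, reached
    along a sequence. *)
Lemma cluster_sequence (tau : R -> R) (K : R) :
  (\forall s \near (0 : R)^'+, `|tau s| <= K) ->
  exists (t : R) (u : nat -> R), [/\ forall n, 0 < u n, u n @[n --> \oo] --> (0 : R) &
    tau (u n) @[n --> \oo] --> t].
Proof.
move=> tauK; pose F := tau @ (0 : R)^'+.
have FK : F `[- K, K]%classic.
  by rewrite /F /=; near=> s; rewrite /= in_itv /= -ler_norml; near: s.
have [t [_ tF]] : `[- K, K]%classic `&` cluster F !=set0.
  by apply: (@segment_compact R (- K) K) => //; exact: fmap_proper_filter.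
have pick n : exists s, [/\ 0 < s, s < n.+1%:R^-1 & `|tau s - t| < n.+1%:R^-1].
  have n0 : 0 < n.+1%:R^-1 :> R by rewrite invr_gt0 ltr0n.
  have FA : F (tau @` [set s | 0 < s < n.+1%:R^-1]).
    rewrite /F /=; near=> s; exists s => //=; apply/andP; split; near: s.
      exact: nbhs_right_gt.
    exact: nbhs_right_lt.
  have [_ [[s /= /andP[s0 sn] <-]]] := tF _ _ FA (nbhsx_ballx t _ n0).
  by rewrite /ball /= distrC; exists s.
have [u uP] := choice pick; exists t, u; split=> [n||].
- by have [] := uP n.
- apply: (@squeeze_cvgr _ _ _ _ (fun=> 0) (fun n => n.+1%:R^-1)).
  + by near=> n; have [/ltW-> /ltW->] := uP n.
  + exact: cvg_cst.
  + exact: cvg_harmonic.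
- apply/cvgrPdist_lt => e e0; near=> n; have [_ _] := uP n.
  rewrite distrC => /lt_trans; apply; near: n.
  exact: near_infty_natSinv_lt (PosNum e0).
Unshelve. all: by end_near.
Qed.

Lemma horner_cvg (p : {poly R}) (u : nat -> R) (t : R) :
  u n @[n --> \oo] --> t -> p.[u n] @[n --> \oo] --> p.[t].
Proof. by move=> ut; apply: continuous_cvg ut; exact: continuous_horner. Qed.

(* The parameters of the points [f s] stay bounded, so they accumulate at some [t]
   as [s] tends to [0]; this [t] lies over [x], and the secants from [x] then tend
   to the tangent of the branch of [p] at [t]. *)
Lemma tangent_at_branch p x d (f : R -> space) :
  (exists i, 1 < size (p i))%N -> f 0 = x ->
  (forall s, 0 < s < 1 -> curve p (f s)) ->
  s^-1 *: (f s - f 0) @[s --> (0 : R)^'+] --> d ->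
  exists2 t : R, x = \row_i (p i).[t] &
    forall m q, (forall i, p i = (x 0 i)%:P + ('X - t%:P) ^+ m * q i) ->
      forall i j, d 0 i * (q j).[t] = d 0 j * (q i).[t].
Proof.
move=> [i0 pi0] f0 fC fd.
have /choice[tau tauP] s : exists t, 0 < s < 1 -> f s = \row_i (p i).[t].
  have [/fC[t _ <-]|ns] := pselect (0 < s < 1); first by exists t.
  by exists 0 => /ns.
have coordd i : s^-1 * (f s 0 i - x 0 i) @[s --> (0 : R)^'+] --> d 0 i.
  rewrite (_ : (fun s => _) = (fun s => (s^-1 *: (f s - f 0)) 0 i)).
    exact: (continuous_cvg _ (@coord_continuous R 1 3 0 i d) fd).
  by apply/funext=> s; rewrite f0 !mxE.
have s01 : \forall s \near (0 : R)^'+, 0 < s < 1.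
  by near=> s; apply/andP; split; near: s; [exact: nbhs_right_gt|exact: nbhs_right_lt].
have coordf i : f s 0 i @[s --> (0 : R)^'+] --> x 0 i.
  have : x 0 i + s * (s^-1 * (f s 0 i - x 0 i)) @[s --> (0 : R)^'+] --> x 0 i + 0 * d 0 i.
    apply: cvgD; first exact: cvg_cst.
    by apply: cvgM; [exact/cvg_at_right_filter/cvg_id|exact: coordd].
  rewrite mul0r addr0; apply: near_cvg_to; near=> s.
  by rewrite mulrA divff ?mul1r ?subrKC // gt_eqF //.
have d1 : \forall s \near (0 : R)^'+, `|x 0 i0 - f s 0 i0| < 1.
  by move/cvgrPdist_lt: (coordf i0); apply.
have [C tauC] : exists C, \forall s \near (0 : R)^'+, `|tau s| <= C.
  have [C hC] := poly_preimage_bounded (`|x 0 i0| + 1) pi0; exists C.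
  near=> s; apply: hC.
  have -> : (p i0).[tau s] = x 0 i0 - (x 0 i0 - f s 0 i0).
    rewrite (tauP s) ?mxE ?subKr //; near: s; exact: s01.
  apply: le_trans (ler_normB _ _) _; rewrite lerD2l; apply: ltW; near: s.
  exact: d1.
have [t [u [u0 ucvg tcvg]]] := cluster_sequence tauC.
have fcvg (g : R -> R) (l : R) : g s @[s --> (0 : R)^'+] --> l -> g (u n) @[n --> \oo] --> l.
  by case: (cvg_at_rightP g 0 l) => + _ => /[apply]; apply.
have u01 : \forall n \near \oo, 0 < u n < 1.
  by near=> n; rewrite u0 /=; near: n; exact: (cvgr_lt _ ucvg).
have xE : x = \row_i (p i).[t].
  apply/rowP=> i; rewrite mxE.
  apply: (cvg_unique _ (fcvg _ _ (coordf i))) => //.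
  apply: (@near_cvg_to _ _ _ _ (fun n => (p i).[tau (u n)])); last exact: horner_cvg.
  near=> n.
  by rewrite (tauP (u n)) ?mxE //; near: n.
exists t => // m q pE i j.
(* Each secant is a scalar multiple of the vector of the [q i] at [tau (u n)], so this minor is 0
   for large [n]; its limit gives the identity. *)
pose h n := (u n)^-1 * (f (u n) 0 i - x 0 i) * (q j).[tau (u n)] -
            (u n)^-1 * (f (u n) 0 j - x 0 j) * (q i).[tau (u n)].
have h0 : h n @[n --> \oo] --> (0 : R).
  apply: near_cvg_to (cvg_cst 0); near=> n.
  have un : f (u n) = \row_i (p i).[tau (u n)] by apply: tauP; near: n.
  rewrite /h un !mxE !pE !hornerE.
  ring.
apply/eqP; rewrite -subr_eq0; apply/eqP.
apply: (cvg_unique _ _ h0) => //.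
by apply: cvgB; (apply: cvgM; [exact: (fcvg _ _ (coordd _))|exact: horner_cvg]).
Unshelve. all: by end_near.
Qed.
End Tangent.

Section TangentLines.
Variable R : realType.
Local Notation space := 'rV[R]_3.

Lemma line_eq_colinear (x v d : space) : line x v = line x d -> exists c, v = c *: d.
Proof.
move=> vd; have : line x v (x + v) by exists 1; rewrite ?scale1r.
by rewrite vd => -[c _ /addrI <-]; exists c.
Qed.

(** The parameters over [x] are among the at most [m] roots of a nonconstant coordinate minus its
    value at [x], and each yields one direction. *)
Lemma tangent_lines_finite (m : nat) (p : 'I_3 -> {poly R}) (x : space) :
  (exists i, 1 < size (p i))%N -> (forall i, size (p i) <= m.+1)%N ->
  exists dv : 'I_m -> space, forall v,
    tangent_line (curve p) x (line x v) ->
    exists2 j, (exists c, v = c *: dv j) & branch p x (dv j).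
Proof.
move=> nc pB; have [i0 pi0] := nc.
pose q0 := p i0 - (x 0 i0)%:P.
have q0n : q0 != 0.
  rewrite subr_eq0; apply: contraTneq pi0 => ->.
  by rewrite -leqNgt size_polyC leq_b1.
have sq0 : (size q0 <= m.+1)%N.
  apply: leq_trans (size_polyD _ _) _; rewrite geq_max pB size_polyN size_polyC.
  by case: (_ != 0).
have [rs srs rsP] := poly_roots_seq q0n.
have srs' : (size rs <= m)%N by rewrite -ltnS; apply: leq_trans srs _.
have /choice[dvt dvtP] t : exists w : space, x = \row_i (p i).[t] ->
    exists e q, [/\ (0 < e)%N, forall i, p i = (x 0 i)%:P + ('X - t%:P) ^+ e * q i,
      forall i, w 0 i = (q i).[t] & w != 0].
  have [e [q [e0 pE [i qi]]]] := branch_exists t nc.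
  exists (\row_i (q i).[t]) => xE; exists e, q; split=> // [j|j|].
  - by rewrite xE mxE.
  - by rewrite mxE.
  - by apply: contraNneq qi => /rowP/(_ i); rewrite !mxE => ->.
(* Indices beyond the list of roots get the default parameter 0; only indices of actual roots are
   chosen below. *)
exists (fun j => dvt (nth 0 rs j)) => v.
move=> [Cs [C [f [d [[_ _ [U _ gU]] CsC [f0 fC _ _] fd [d0 ld]]]]]].
have [c ->] := line_eq_colinear ld.
have [|t xE dP] := tangent_at_branch nc f0 _ fd.
  move=> s /andP[s0 s1]; suff [] : (curve p `&` U) (f s) by [].
  rewrite gU; exists C => //; rewrite -fC; exists s => //=.
  by rewrite in_itv /= ltW.
have trs : t \in rs by apply: rsP; rewrite /root /q0 !hornerE xE mxE subrr.
have jm : (index t rs < m)%N by apply: leq_trans srs'; rewrite index_mem.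
have [e [q [e0 pE wE w0]]] := dvtP t xE.
exists (Ordinal jm); rewrite /= nth_index //; last by exists t, e, q.
have [j wj] : exists j, dvt t 0 j != 0.
  apply/existsP; apply: contraNT w0; rewrite negb_exists => /forallP h.
  by apply/eqP/rowP=> j; rewrite mxE; apply/eqP; have := h j; rewrite negbK.
exists (c * (d 0 j / dvt t 0 j)); apply/rowP=> i; rewrite !mxE -mulrA; congr (_ * _).
apply: (mulIf wj); rewrite mulrAC mulfVK // !wE.
exact: (dP e q pE).
Qed.
End TangentLines.

(** * Summation over the points *)

Section SumBound.
Variables (R : realType) (k L m : nat) (X : 'I_k -> 'rV[R]_3).
Variable p : 'I_L -> 'I_3 -> {poly R}.

(* A pair in ['I_L * 'I_m] stands for a curve and one of its at most [m] branches
   at [X x]; only the curve matters for membership. *)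
Definition branch_triples x : {set {ffun 'I_3 -> 'I_L * 'I_m}} :=
  [set a : {ffun 'I_3 -> 'I_L * 'I_m} |
    `[< exists2 M : 'M[R]_3, row_free M &
          forall i, branch (p (a i).1) (X x) (row i M) >]].

Lemma sum_sqrt_branch_triples : injective X -> (0 < m)%N ->
  (forall l i, size (p l i) <= m.+1)%N ->
  \sum_x Num.sqrt #|branch_triples x|%:R <= (12 * m ^ 3)%:R * L%:R `^ (3 / 2) :> R.
Proof.
move=> injX m0 pm; pose a x : R := Num.sqrt #|branch_triples x|%:R.
set T := \sum_x _; have a0 x : 0 <= a x by exact: sqrtr_ge0.
have T0 : 0 <= T by apply: sumr_ge0 => x _; exact: a0.
have rhs0 : 0 <= (12 * m ^ 3)%:R * L%:R `^ (3 / 2) :> R.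
  by rewrite mulr_ge0 ?ler0n ?powR_ge0.
have [->//|Tn0] := eqVneq T 0.
have Tp : 0 < T by rewrite lt0r Tn0.
(* Then [n > 6 * k ^ 2], so the total loss [k * (n ^ 3 - n' ^ 3)] is at most
   [3 * k ^ 2 * n ^ 2 < n ^ 3 / 2]. *)
pose n' := (6 * k ^ 2).+1; pose n := (n' + k)%N.
(* Scaled so that the [w x] add up to [n ^ 3 / 2]. *)
pose w x : R := (n ^ 3)%:R * a x / (2 * T).
have w0 x : 0 <= w x by rewrite /w !mulr_ge0 ?invr_ge0 ?mulr_ge0.
have wn : \sum_x (w x + (n ^ 3 - n' ^ 3)%:R) < (n ^ 3)%:R.
  rewrite big_split /= sumr_const card_ord -mulr_suml -mulr_sumr -/T.
  have -> : (n ^ 3)%:R * T / (2 * T) = (n ^ 3)%:R / 2 :> R by field.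
  rewrite -[_ *+ k]mulr_natr -natrM.
  suff : (2 * ((n ^ 3 - n' ^ 3) * k) < n ^ 3)%N.
    by rewrite -(ltr_nat R) natrM; lra.
  have -> : (n ^ 3 - n' ^ 3 = k * (n ^ 2 + n * n' + n' ^ 2))%N.
    by rewrite /n; lia.
  have nn' : (n' <= n)%N by rewrite leq_addr.
  have h1 : (n ^ 2 + n * n' + n' ^ 2 <= 3 * n ^ 2)%N by nia.
  have h2 : (6 * k ^ 2 < n)%N by exact: leq_trans nn'.
  have n0 : (0 < n)%N by [].
  apply: (@leq_ltn_trans (n ^ 2 * (6 * k ^ 2))%N).
    have -> : (2 * (k * (n ^ 2 + n * n' + n' ^ 2) * k) =
      2 * k ^ 2 * (n ^ 2 + n * n' + n' ^ 2))%N by ring.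
    by apply: leq_trans (leq_mul (leqnn _) h1) _; apply: eq_leq; ring.
  by rewrite [ltnRHS]expnSr ltn_pmul2l // expn_gt0.
have [S [Sl Sw]] := joint_weights injX pm w0 wn.
pose s x := (\sum_l m * S l x)%N.
(* [a x ^+ 2] counts triples, each bounding [w x] by a product of three values of [S]; over all
   triples these products sum to a cube. *)
have cube x : a x ^+ 2 * w x <= (s x)%:R ^+ 3.
  rewrite /a sqr_sqrtr ?ler0n // -sum1_card natr_sum mulr_suml.
  apply: (@le_trans _ _ (\sum_(c in branch_triples x) (\prod_i S (c i).1 x)%:R)).
    apply: ler_sum => c; rewrite inE mul1r => /asboolP[M fM brM].
    exact: (Sw x (fun i => (c i).1) M fM brM).
  apply: (@le_trans _ _ (\sum_(c : {ffun 'I_3 -> 'I_L * 'I_m}) (\prod_i S (c i).1 x)%:R)).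
    by rewrite [leRHS](bigID (mem (branch_triples x))) /= lerDl sumr_ge0.
  rewrite -natr_sum -(bigA_distr_bigA (fun _ c => S c.1 x)) /= prod_nat_const.
  rewrite card_ord natrX lerXn2r ?nnegrE ?ler0n // ler_nat.
  rewrite -(pair_bigA _ (fun l _ => S l x)) /=.
  by apply: leq_sum => l _; rewrite sum_nat_const card_ord.
(* As [w x] is proportional to [a x], the left side of [cube] is [(n * a x) ^ 3 / (2 * T)], and cube
   roots can be taken. *)
pose K := (2 * T) `^ (3^-1); have K0 : 0 <= K by exact: powR_ge0.
have K3 : K ^+ 3 = 2 * T.
  by rewrite -powR_mulrn // -powRrM mulVf // powRr1 // mulr_ge0.
have key x : n%:R * a x <= K * (s x)%:R.
  rewrite -(@ler_pXn2r _ 3) ?nnegrE ?mulr_ge0 // !exprMn K3.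
  have := ler_wpM2l (ltW (_ : 0 < 2 * T)) (cube x); rewrite mulr_gt0 // => /(_ isT).
  apply: le_trans; rewrite /w natrX le_eqVlt; apply/orP; left; apply/eqP.
  by field.
have sumS : (\sum_x s x <= 4 * m ^ 2 * n * L)%N.
  rewrite /s exchange_big /=; apply: (@leq_trans (\sum_(l < L) 4 * m ^ 2 * n)%N).
    apply: leq_sum => l _; rewrite -big_distrr /=.
    apply: leq_trans (leq_mul (leqnn m) (Sl l)) _.
    have -> : (4 * m ^ 2 * n = m * (3 * m * n + m * n))%N by ring.
    by rewrite leq_mul2l leq_add2l muln_gt0 m0 orbT.
  by rewrite sum_nat_const card_ord mulnC.
have TK : T <= 4 * m%:R ^+ 2 * L%:R * K.
  have n0 : 0 < n%:R :> R by rewrite ltr0n.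
  rewrite -(ler_pM2l n0) {1}/T mulr_sumr.
  apply: le_trans (ler_sum _ (fun x _ => key x)) _.
  rewrite -mulr_sumr -natr_sum.
  apply: (@le_trans _ _ (K * (4 * m ^ 2 * n * L)%:R)); first by rewrite ler_wpM2l ?ler_nat.
  by rewrite !natrM le_eqVlt; apply/orP; left; apply/eqP; ring.
(* Cubing and dividing by [T] leaves the constant [2 * 4 ^ 3 = 128], rounded up to the square
   144. *)
have T2 : T ^+ 2 <= (12 * m%:R ^+ 3) ^+ 2 * L%:R ^+ 3.
  have : T ^+ 3 <= (4 * m%:R ^+ 2 * L%:R * K) ^+ 3.
    by rewrite lerXn2r ?nnegrE // !mulr_ge0 ?exprn_ge0.
  have -> : (4 * m%:R ^+ 2 * L%:R * K) ^+ 3 = T * (128 * (m%:R ^+ 2 * L%:R) ^+ 3).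
    by rewrite exprMn K3; ring.
  rewrite exprS ler_pM2l // => /le_trans; apply.
  have -> : (12 * m%:R ^+ 3) ^+ 2 * L%:R ^+ 3 = 144 * (m%:R ^+ 2 * L%:R) ^+ 3 :> R.
    by ring.
  by rewrite ler_wpM2r ?ler_nat // exprn_ge0 // mulr_ge0 ?exprn_ge0.
rewrite -(@ler_pXn2r _ 2) ?nnegrE // -/T exprMn.
have -> : (L%:R `^ (3 / 2)) ^+ 2 = L%:R ^+ 3 :> R.
  rewrite -powR_mulrn ?powR_ge0 // -powRrM mulfVK //.
  by rewrite -[3]/(3%:R) powR_mulrn.
by rewrite natrM natrX.
Qed.
End SumBound.

(** * From multiplicities to branch triples *)

Lemma counting_le_image (R : realType) (T : choiceType) (I : finType)
    (A : set T) (B : {set I}) (f : I -> T) :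
  (forall y, A y -> exists2 i, i \in B & y = f i) ->
  exists2 N : nat, counting A = N%:R%:E :> \bar R & (N <= #|B|)%N.
Proof.
move=> AB; pose D := [fset y in [seq f i | i <- enum B]]%fset.
have AD y : A y -> y \in D.
  by move=> /AB[i iB ->]; rewrite !inE; apply/mapP; exists i; rewrite ?mem_enum.
have finA : finite_set A by apply: (@sub_finite_set _ _ [set` D]) => //.
exists #|` fset_set A|%fset; first by rewrite /counting asboolT.
apply: leq_trans (_ : (#|` D| <= _)%N).
  by apply/fsubset_leq_card/fsubsetP=> y; rewrite in_fset_set // inE => /AD.
by rewrite card_fseq (leq_trans (size_undup _)) // size_map cardE.
Qed.

(** Each line of a triple is spanned by a branch direction; a curve and a branch index for each line
    determine the triple. *)
Lemma multiplicity_le (R : realType) (k L m : nat) (Gamma : set (set 'rV[R]_3))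
    (X : 'I_k -> 'rV[R]_3) (p : 'I_L -> 'I_3 -> {poly R}) (i : 'I_k) :
  (forall gamma, Gamma gamma -> exists l, gamma = curve (p l)) ->
  (forall l, exists i, 1 < size (p l i))%N ->
  (forall l i, size (p l i) <= m.+1)%N ->
  exists2 N : nat, multiplicity Gamma (X i) = N%:R%:E &
    (N <= #|branch_triples m X p i|)%N.
Proof.
move=> Gp nc pm; set x := X i.
have /choice[dv dvP] l := tangent_lines_finite x (nc l) (pm l).
apply: (@counting_le_image R _ _ _ _
  (fun a : {ffun 'I_3 -> 'I_L * 'I_m} => [set line x (dv (a j).1 (a j).2) | j in [set: 'I_3]])).
move=> _ [V [dirV fV ->]].
have codes j : exists c : 'I_L * 'I_m, (exists s, row j V = s *: dv c.1 c.2) /\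
    branch (p c.1) x (dv c.1 c.2).
  have [_ [gamma [/Gp[l ->] _ /(dvP l)[t hc hb]]]] := dirV j.
  by exists (l, t).
have [c cP] := choice codes.
have /choice[s sP] j := (cP j).1.
pose M := \matrix_j dv (c j).1 (c j).2.
(* As [V] is invertible, the scaling factors are nonzero and the branch directions independent. *)
have VM : V = diag_mx (\row_j s j) *m M.
  apply/matrixP=> j h; rewrite mul_diag_mx !mxE.
  by have /rowP/(_ h) := sP j; rewrite !mxE.
have s0 j : s j != 0.
  move: fV; rewrite row_free_unit VM unitmx_mul unitmxE det_diag unitfE.
  by case/andP=> /prodf_neq0/(_ j isT); rewrite mxE.
exists [ffun j => c j].
  rewrite inE; apply/asboolP; exists M.
    by move: fV; rewrite !row_free_unit VM unitmx_mul => /andP[].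
  by move=> j; rewrite rowK ffunE; apply: (cP j).2.
apply/seteqP; split=> _ [j _ <-]; exists j => //; rewrite ffunE sP; apply/seteqP.
  split=> _ [t _ <-]; [exists (t / s j)|exists (t * s j)] => //.
    by rewrite scalerA mulfVK.
  by rewrite scalerA.
split=> _ [t _ <-]; [exists (t * s j)|exists (t / s j)] => //.
  by rewrite scalerA.
by rewrite scalerA mulfVK.
Qed.

Theorem corollary6p1p6 (R : realType) (b : R) (hb : 0 < b) :
  exists c : R, forall Gamma : set (set 'rV[R]_3),
    finite_set Gamma ->
    (forall gamma, Gamma gamma -> poly_curve b gamma) ->
    (\esum_(x in joints Gamma) (multiplicity Gamma x `^ (1 / 2))
       <= (c * #|` fset_set Gamma|%:R `^ (3 / 2))%:E)%E.
Proof.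
(* Degrees at most [b] are at most [m]; the successor ensures [m > 0]. *)
pose m := (Num.truncn b).+1; exists (12 * m ^ 3)%:R => Gamma finG Gb.
have /choice[P PP] gamma : exists p : 'I_3 -> {poly R}, Gamma gamma ->
    [/\ exists i, (1 < size (p i))%N, forall i, (size (p i) <= m.+1)%N &
        gamma = curve p].
  have [/Gb[p [nc pb ->]]|nG] := pselect (Gamma gamma); last first.
    by exists (fun=> 0) => /nG.
  exists p => _; split=> // i; have := pb i.
  by rewrite -truncn_ge_nat ?ltW // /m; lia.
pose gs : seq (set 'rV[R]_3) := fset_set Gamma; pose L := size gs.
have gsG (l : 'I_L) : Gamma (nth set0 gs l).
  by have := mem_nth set0 (ltn_ord l); rewrite in_fset_set // inE.
pose p (l : 'I_L) := P (nth set0 gs l).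
have Gp gamma : Gamma gamma -> exists l, gamma = curve (p l).
  move=> Gg; have gg : gamma \in gs by rewrite in_fset_set // inE.
  have lL : (index gamma gs < L)%N by rewrite index_mem.
  exists (Ordinal lL); rewrite /p /= nth_index //.
  by have [] := PP _ Gg.
have nc l : exists i, (1 < size (p l i))%N by have [] := PP _ (gsG l).
have pm l i : (size (p l i) <= m.+1)%N by have [_ h _] := PP _ (gsG l); exact: h.
(* The sum is the supremum of its finite partial sums; the points of [A] are listed as [X]. *)
apply: ub_ereal_sup => _ [A [finA _] <-].
rewrite fsbig_finite //=; set xs : seq 'rV[R]_3 := fset_set A.
rewrite (big_nth 0) big_mkord; pose X (i : 'I_(size xs)) := nth 0 xs i.
have injX : injective X.
  by move=> i j /eqP; rewrite nth_uniq ?fset_uniq // => /eqP/val_inj.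
apply: (@le_trans _ _ (\sum_i (Num.sqrt #|branch_triples m X p i|%:R)%:E)%E).
  apply: lee_sum => i _.
  have [N -> NB] := multiplicity_le X i Gp nc pm.
  rewrite poweR_EFin lee_fin div1r powR12_sqrt ?ler0n //.
  by rewrite ler_wsqrtr // ler_nat.
rewrite sumEFin lee_fin.
exact: sum_sqrt_branch_triples.
Qed.
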